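(* For $n\ge 1$ let $p_2'(n)$ be the number of pairs $(\lambda,\mu)$, where $\lambda\ge 1$ is an integer (the one part guaranteed to appear at least once) and $\mu$ is a finite, possibly empty, multiset of positive integers (the remaining parts), such that $\lambda$ plus the sum of the elements of $\mu$ equals $n$, and every element of $\mu$ is either an odd number less than $2\lambda$ or equal to $2\lambda$ (each allowed value occurring any number of times or not at all). Let $p_2(n)$ be the weighted count of the same pairs, each counted with weight $(-1)^{|\mu|}$, where $|\mu|$ is the number of elements of $\mu$ counted with multiplicity (the number of parts outside of the guaranteed part $\lambda$). Then, as $z\to1^-$, $$\sum_{n\ge1}p_2(n)z^n=O\left(\frac{1}{1-z}\right)$$ and $$\sum_{\substack{n\ge 1\\ p_2(n)>0}} z^n=O\left(\frac{1}{(1-z)\sqrt{\log\left(\frac{1}{1-z}\right)}}\right).$$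
   Context: The variable $z$ is real, $0<z<1$. The notation $f(z)=O(g(z))$ as $z\to1^-$ means that there is a constant $K>0$ such that $|f(z)|\le K g(z)$ for all $z<1$ sufficiently close to $1$. The sum over $p_2(n)>0$ runs over those $n\ge1$ for which the integer $p_2(n)$ is strictly positive. *)

(* Defs.v *)
From mathcomp Require Import all_boot all_order all_algebra.
From mathcomp Require Import finmap multiset.
From mathcomp Require Import all_classical all_reals all_analysis.

Set Implicit Arguments.
Unset Strict Implicit.
Unset Printing Implicit Defensive.

Import Order.TTheory GRing.Theory Num.Theory.
Import numFieldNormedType.Exports.

Local Open Scope mset_scope.
Local Open Scope classical_set_scope.
Local Open Scope ring_scope.

(* For l >= 1 every allowed k is positive. *)
Definition allowed_part (l k : nat) : bool :=
  (odd k && (k < 2 * l)%N) || (k == 2 * l)%N.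

(* A pair (l, mu): the guaranteed part and the multiset of remaining parts.
   A multiset coerces to the list of its elements with multiplicity. *)
Definition p2_pairs (n : nat) : set (nat * {mset nat}) :=
  [set x : nat * {mset nat} | [/\ (0 < x.1)%N,
               (x.1 + \sum_(k <- x.2) k)%N = n &
               forall k : nat, k \in x.2 -> allowed_part x.1 k]].

(* The two counts below are over a finite set, so neither `fset_set` nor the
   finitely supported sum falls back to its default value. *)
Lemma p2_pairs_finite (n : nat) : finite_set (p2_pairs n).
Proof.
pose f (u : 'I_n.+1 * n.-bseq 'I_n.+1) : nat * {mset nat} :=
  (u.1 : nat, seq_mset [seq nat_of_ord i | i <- u.2]).
apply: (@sub_finite_set _ _ (f @` setT)); last first.
  exact/finite_image/finite_finset.
move=> [l m] [/= l0 sumE allow].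
have gt0 k : k \in m -> (0 < k)%N.
  move=> /allow/orP[/andP[ok _]|/eqP->]; last by rewrite muln_gt0.
  by case: k ok.
have sum_ge : (size m <= \sum_(k <- m) k)%N.
  rewrite -sum1_size big_seq [leqRHS]big_seq.
  by apply: leq_sum => k; exact: gt0.
have size_le : (size m <= n)%N by rewrite (leq_trans sum_ge)// -sumE leq_addl.
have elt_le k : k \in m -> (k < n.+1)%N.
  move=> km; rewrite ltnS -sumE (leq_trans _ (leq_addl _ _))//.
  by rewrite (big_rem k) ?leq_addr.
have sz : (size [seq inord k : 'I_n.+1 | k <- m] <= n)%N by rewrite size_map.
have ln : (l < n.+1)%N by rewrite ltnS -sumE leq_addr.
exists (Ordinal ln, Bseq sz) => //.
rewrite /f /=; congr pair.
rewrite -map_comp -[RHS]seq_mset_id; congr seq_mset.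
rewrite -[RHS]map_id; apply/eq_in_map => k km /=.
by rewrite inordK// elt_le.
Qed.

Definition p2' (n : nat) : nat := #|` fset_set (p2_pairs n)|.

Definition p2_weight (x : nat * {mset nat}) : int := (-1) ^+ size x.2.

Definition p2 (n : nat) : int := \sum_(x \in p2_pairs n) p2_weight x.

Definition p2_series (R : realType) (z : R) : R^nat :=
  [sequence \sum_(1 <= n < N) (p2 n)%:~R * z ^+ n]_N.

Definition p2_pos_series (R : realType) (z : R) : R^nat :=
  [sequence \sum_(1 <= n < N | 0 < p2 n) z ^+ n]_N.

Definition bigO_left1 (R : realType) (f g : R -> R) : Prop :=
  exists2 K : R, 0 < K & \forall z \near 1^'-, `|f z| <= K * g z.

(* Main.v *)
Require Import Defs.
From mathcomp Require Import all_boot all_order all_algebra zify ring lra.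
From mathcomp Require Import finmap multiset.
From mathcomp Require Import all_classical all_reals all_analysis.

(** Summing the pairs over mu for each value of the guaranteed part gives
      sum_n p2(n) q^n = sum_(l >= 1) q^l / ((1+q)(1+q^3)...(1+q^(2l-1)) (1+q^(2l))).
    Everything rests on the fact that this series is a partial theta function
    in two variables,
      sum_n p2(n) q^n = sum_(1 <= s <= m) (-1)^h q^(m^2 + 2 h^2),   h = floor(s/2),
    which is [p2_theta].  Hence p2(n) is a signed count of pairs (s, m) with
    1 <= s <= m and m^2 + 2 h^2 = n, and both claims become statements about
    the quadratic form x^2 + 2 y^2.

    The identity.  With Q = q^2 the l-th term is q^l (1+Q)...(1+Q^(l-1)) over
    (1+q)(1+q^2)...(1+q^(2l)).  A finite form of the pentagonal number theorem
    ([finite_theta]) expands the numerator as a signed sum over s of Gaussian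
    binomials [2l-1, l+s-1] in base Q.  After exchanging the sums one needs, for
    every s, the sum over l of q^l [2l-1, l+s-1] / ((1+q)...(1+q^(2l))), which
    is an instance of the q-Gauss sum; it is computed by a
    Wilf-Zeilberger pair ([gauss_certP]).  All of this is carried out for
    partial sums over l <= N, with an explicit remainder, as identities between
    rational functions of a real number q in (0, 1).  The remainder is O(q^(N+1))
    there, and a polynomial that is O(q^(N+1)) near 0 has no coefficient of
    degree at most N ([order_coef]), so the coefficients up to N agree.

    The first bound.  The pairs that contribute to p2(1), ..., p2(n) satisfy
    s <= m <= sqrt n, so the sum of |p2(i)| over i <= n is at most n, and a
    summation by parts ([abel_bound]) gives sum |p2(n)| z^n <= 1/(1-z).

    The second bound.  If p2(n) > 0 then n = x^2 + 2 y^2, and such integers have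
    density O(1 / sqrt(log n)), by the theorem of Landau.  Only the upper bound
    is needed, and it can be had without Dirichlet's theorem on primes.  Let chi
    be the character modulo 8 with chi(1) = chi(3) = 1 and
    chi(5) = chi(7) = -1.  A prime with chi = -1 that divides x^2 + 2 y^2 divides
    x and y ([inert_dvd], by Thue's lemma), so n = k^2 m or n = 2 k^2 m with m
    a product of primes with chi = 1 ([quadratic_form_split]).  For such m all
    divisors d have chi(d) = 1, hence the number of divisors of m is
    r(m) = sum_(d | m) chi(d), while r >= 0 always.  Consequently the square of
    B(x) = sum 1/m, over such m <= x, is at most the sum of r(n)/n over
    n <= x^2, and this is O(log x) because the partial sums of chi(d)/d are
    bounded ([smooth_harmonic_sq]).  Writing log n as a sum of the von Mangoldt
    function over the divisors of n and using the Chebyshev bound psi(y) = O(y)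
    one finds that the sum of log m over such m <= x is O(x B(x)), that is
    O(x sqrt(log x)), so that there are O(x / sqrt(log x)) such m up to x
    ([smooth_count_le]).  The squares k^2 cost only a factor sum 1/k^2, and
    [abel_bound] turns the count into the bound for the power series. *)

Set Implicit Arguments.
Unset Strict Implicit.
Unset Printing Implicit Defensive.

Import Order.TTheory GRing.Theory Num.Theory.
Import numFieldNormedType.Exports.

Local Open Scope classical_set_scope.
Local Open Scope ring_scope.

(** * Elementary tools *)

(** Summation by parts: against a nonincreasing weight, a linear bound on the
    partial sums of [f] may be used as if it held term by term.  The weights
    below are [z ^+ i], which turns counting functions into power series, and
    [1 / i], for the character sum. *)
Lemma abel_bound (R : realFieldType) (f w : nat -> R) (a b : R) (M : nat) :
    0 <= a -> (forall n, 0 <= w n) -> (forall n, w n.+1 <= w n) ->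
    (forall n, \sum_(1 <= i < n.+1) f i <= a + b * n%:R) ->
  \sum_(1 <= i < M.+1) f i * w i <= a * w 1%N + b * \sum_(1 <= i < M.+1) w i.
Proof.
move=> a0 w0 wdec fle.
pose S n := \sum_(1 <= i < n.+1) (f i - b).
have Sle n : S n <= a.
  by rewrite /S sumrB big_const_nat iter_addr_0 subn1 lerBlDr -mulr_natr.
have key n : \sum_(1 <= i < n.+2) (f i - b) * w i - S n.+1 * w n.+1
             <= a * (w 1%N - w n.+1).
  elim: n => [|n IHn]; first by rewrite /S !big_nat1 !subrr mulr0.
  rewrite big_nat_recr//=.
  have -> : S n.+2 = S n.+1 + (f n.+2 - b) by rewrite /S big_nat_recr.
  have := ler_wpM2r (_ : 0 <= w n.+1 - w n.+2) (Sle n.+1).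
  by rewrite subr_ge0 => /(_ (wdec _)); lra.
case: M => [|n]; first by rewrite !big_geq// mulr0 addr0 mulr_ge0.
have := key n; have := ler_wpM2r (w0 n.+1) (Sle n.+1).
under [X in _ -> X - _ <= _ -> _]eq_bigr do rewrite mulrBl.
rewrite sumrB -mulr_sumr; lra.
Qed.

Lemma floor_sqrt n : exists K, (K ^ 2 <= n < K.+1 ^ 2)%N.
Proof.
elim: n => [|n [K /andP[Kn nK]]]; first by exists 0%N.
move: nK; rewrite leq_eqVlt => /orP[/eqP E|lt]; last first.
  by exists K; rewrite (leq_trans Kn).
by exists K.+1; rewrite E leqnn /= ltn_sqr.
Qed.

(** * From pairs to truncated products *)

Section Multiplicities.
Variable B : nat.
Implicit Type f : {ffun 'I_B -> 'I_B}.

(** A multiset of parts below [B] with multiplicities below [B] is encoded by its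
    multiplicity function, so that expanding a product of truncated geometric
    series enumerates exactly these functions. *)
Definition parts_of f : seq nat :=
  flatten [seq nseq (f k) (nat_of_ord k) | k <- enum 'I_B].

Lemma big_parts_of (F : nat -> nat) f :
  (\sum_(k <- seq_mset (parts_of f)) F k = \sum_(k < B) f k * F k)%N.
Proof.
rewrite (perm_big _ (perm_eq_seq_mset _)) /parts_of big_flatten big_map big_enum.
by apply: eq_bigr => k _; rewrite big_nseq iter_addn_0 mulnC.
Qed.

Lemma size_parts_of f : size (seq_mset (parts_of f)) = (\sum_(k < B) f k)%N.
Proof.
by rewrite -sum1_size big_parts_of; apply: eq_bigr => k _; rewrite muln1.
Qed.

Lemma parts_ofE f (k : 'I_B) : seq_mset (parts_of f) k = f k.
Proof.
rewrite mset_seqE /parts_of count_flatten -map_comp sumnE big_map big_enum.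
rewrite (bigD1 k)//= big1 ?addn0 => [|j jk]; rewrite count_nseq /= ?eqxx ?mul1n//.
by move: jk; rewrite -val_eqE /= => /negbTE ->.
Qed.

Lemma parts_of_out f k : (B <= k)%N -> seq_mset (parts_of f) k = 0%N.
Proof.
move=> Bk; rewrite mset_seqE; apply/count_memPn/flatten_mapP => -[j _].
by rewrite mem_nseq => /andP[_ /eqP kj]; move: Bk; rewrite kj leqNgt ltn_ord.
Qed.

Definition admissible n (u : 'I_B * {ffun 'I_B -> 'I_B}) :=
  [&& (0 < u.1)%N, (u.1 + \sum_(k < B) u.2 k * k == n)%N &
      [forall k : 'I_B, (0 < u.2 k)%N ==> allowed_part u.1 k]].

Lemma p2_pairs_bounds n (l : nat) (m : {mset nat}%mset) :
    (n < B)%N -> p2_pairs n (l, m) ->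
  [/\ (l < B)%N, (forall k, k \in m -> (k < B)%N) & (forall k, (m k < B)%N)].
Proof.
move=> nB [/= l0 sumE al].
have gt0 k : k \in m -> (0 < k)%N.
  by move=> /al/orP[/andP[ok _]|/eqP->]; [exact: odd_gt0|rewrite muln_gt0].
have size_le : (size m <= n)%N.
  rewrite -sumE -sum1_size; apply: leq_trans (leq_addl _ _).
  by rewrite big_seq [leqRHS]big_seq; apply: leq_sum => k; exact: gt0.
split => //.
- by apply: leq_ltn_trans nB; rewrite -sumE leq_addr.
- move=> k km; apply: leq_ltn_trans nB; rewrite -sumE (leq_trans _ (leq_addl _ _))//.
  by rewrite (big_rem k) ?leq_addr.
- move=> k; rewrite -count_mem_mset; apply: leq_ltn_trans nB.
  by apply: leq_trans size_le; exact: count_size.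
Qed.

Lemma p2_multiplicities n : (n < B)%N ->
  p2 n = \sum_(u | admissible n u) (-1) ^+ (\sum_(k < B) u.2 k)%N.
Proof.
move=> nB; rewrite /p2.
pose h (u : 'I_B * {ffun 'I_B -> 'I_B}) :=
  (nat_of_ord u.1, seq_mset (parts_of u.2)).
rewrite (reindex_fsbig h [set` enum (admissible n)]%classic).
  rewrite -fsbig_seq ?enum_uniq// big_enum.
  by apply: eq_bigr => u _; rewrite /p2_weight size_parts_of.
have -> : [set` enum (admissible n)]%classic = [set u | admissible n u]%classic.
  by apply/seteqP; split => u /=; rewrite mem_enum.
split.
- move=> [l f] /and3P[/= l0 /eqP sumE /forallP al]; split => //=.
    by rewrite big_parts_of.
  move=> k; rewrite in_mset.
  have [kB|Bk] := ltnP k B; last by rewrite parts_of_out.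
  by rewrite (parts_ofE f (Ordinal kB)) => fk; apply: (implyP (al (Ordinal kB))).
- move=> [l f] [l' f'] _ _ [/= /val_inj -> E]; congr pair.
  by apply/ffunP => k; apply/val_inj; rewrite /= -!parts_ofE E.
- move=> [l m] lm; have [lB elt_le mult_lt] := p2_pairs_bounds nB lm.
  case: lm => /= l0 sumE al.
  pose f := [ffun k : 'I_B => Ordinal (mult_lt k)].
  have fE : seq_mset (parts_of f) = m.
    apply/msetP => k; have [kB|Bk] := ltnP k B.
      by rewrite (parts_ofE f (Ordinal kB)) ffunE.
    rewrite parts_of_out//; apply/esym/mset_eq0P.
    by apply/negP => /elt_le; rewrite ltnNge Bk.
  exists (Ordinal lB, f); last by rewrite /h/= fE.
  apply/and3P; split => //=; first by rewrite -(big_parts_of id) fE; apply/eqP.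
  by apply/forallP => k; apply/implyP; rewrite ffunE/= -in_mset; exact: al.
Qed.

(** Truncation of the power series of 1 / (1 + 'X^k). *)
Definition signed_geom (k : nat) : {poly int} := \sum_(i < B) (- 'X^k) ^+ i.

Definition parts_poly (l : nat) : {poly int} :=
  \prod_(k < B | allowed_part l k) signed_geom k.

(** Expanding the product chooses one power of each factor; the choices are the
    multiplicity functions, and the sign collected is the parity of the number
    of parts. *)
Lemma coef_parts_poly l j : (0 < B)%N -> (parts_poly l)`_j =
  \sum_(f : {ffun 'I_B -> 'I_B} | (\sum_(k < B) f k * k == j)%N &&
      [forall k : 'I_B, (0 < f k)%N ==> allowed_part l k])
    (-1) ^+ (\sum_(k < B) f k)%N.
Proof.
move=> B0.
rewrite /parts_poly big_mkcond /=.
pose F (k i : 'I_B) : {poly int} :=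
  if allowed_part l k then (- 'X^k) ^+ i else (i == 0 :> nat)%:R.
rewrite (eq_bigr (fun k => \sum_i F k i)); last first.
  move=> k _; rewrite /F; case: allowed_part => //.
  rewrite (bigD1 (Ordinal B0))//= big1 ?addr0// => i.
  by rewrite -val_eqE /= => /negbTE ->.
rewrite bigA_distr_bigA /= coef_sum [RHS]big_mkcond; apply: eq_bigr => f _.
have [al|] := boolP [forall k : 'I_B, (0 < f k)%N ==> allowed_part l k].
  rewrite (eq_bigr (fun k => (-1) ^+ f k * 'X^(f k * k))); last first.
    move=> k _; rewrite /F; have := forallP al k; case: allowed_part.
      by move=> _; rewrite [LHS]exprNn -exprM [(k * _)%N]mulnC.
    by rewrite implybF -eqn0Ngt => /eqP ->; rewrite mul0n mulr1.
  rewrite big_split/= -expr_sum -expr_sum andbT.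
  set a := (\sum_(k < B) f k)%N; set b := (\sum_(k < B) f k * k)%N.
  have -> : (-1) ^+ a * 'X^b = (-1) ^+ a *: 'X^b :> {poly int}.
    by rewrite -mul_polyC rmorphXn rmorphN1.
  by rewrite coefZ coefXn eq_sym; case: eqP; rewrite ?mulr1 ?mulr0.
rewrite negb_forall andbF => /existsP[k]; rewrite negb_imply => /andP[fk al].
rewrite (bigD1 k)//= {1}/F (negbTE al) -(negbK (_ == _ :> nat)) -lt0n fk mul0r.
by rewrite coef0.
Qed.

(** Multiplicities and parts are at most [n], so truncating at any [B > n] does not
    affect the coefficient of 'X^n. *)
Lemma p2_coef N n : (n <= N < B)%N ->
  p2 n = (\sum_(1 <= l < N.+1) 'X^l * parts_poly l)`_n.
Proof.
move=> /andP[nN NB]; have nB := leq_ltn_trans nN NB.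
have B0 : (0 < B)%N := leq_ltn_trans (leq0n _) NB.
rewrite p2_multiplicities//.
transitivity (\sum_(l < B | (0 < l <= n)%N) (parts_poly l)`_(n - l)).
  under [RHS]eq_bigr do rewrite coef_parts_poly//.
  rewrite pair_big_dep/=; apply: eq_big => // -[l f].
  rewrite /admissible /=; case: (0 < l)%N => //=.
  have [ln|nl] := leqP l n.
    by rewrite -(eqn_add2l l (\sum_(k < B) _)) subnKC.
  case: eqP => //= E; move: nl; rewrite -E ltnNge leq_addr//.
rewrite coef_sum.
rewrite -(big_mkord (fun l => 0 < l <= n)%N (fun l => (parts_poly l)`_(n - l))).
rewrite [RHS](big_nat_widenl 1 0)// [RHS](big_nat_widen 0 _ B)//.
rewrite [LHS]big_mkcond [RHS]big_mkcond; apply: eq_bigr => l _.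
rewrite coefXnM ltnS lt0n; case: (l == 0)%N => //=.
by case: (ltnP n l) => nl /=; rewrite ?if_same// (leq_trans nl nN).
Qed.
End Multiplicities.

(** * Gaussian binomials and the Hecke-type identity *)

Section QBinomial.
Variables (F : realFieldType) (Q : F).

(** Gaussian binomials by the Pascal recursion rather than by quotients of
    products: they vanish for [n < k], so that in the sums below the
    ranges of summation may be enlarged freely. *)
Fixpoint qbin (n k : nat) : F :=
  match n, k with
  | _, 0 => 1
  | 0, _.+1 => 0
  | n'.+1, k'.+1 => qbin n' k' + Q ^+ k * qbin n' k
  end.

Lemma qbin0 n : qbin n 0 = 1. Proof. by case: n. Qed.

Lemma qbinS n k : qbin n.+1 k.+1 = qbin n k + Q ^+ k.+1 * qbin n k.+1.
Proof. by []. Qed.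

Lemma qbin_small n k : (n < k)%N -> qbin n k = 0.
Proof.
elim: n k => [|n IH] [|k]//= nk; rewrite !IH ?mulr0 ?addr0//; exact: ltnW.
Qed.

Lemma qbinn n : qbin n n = 1.
Proof. by elim: n => //= n ->; rewrite qbin_small// mulr0 addr0. Qed.

(** The second Pascal rule.  Comparing it with the defining one gives the ratio
    of neighbouring Gaussian binomials without any division. *)
Lemma qbinS_dual n k : qbin n.+1 k.+1 = Q ^+ (n - k) * qbin n k + qbin n k.+1.
Proof.
elim: n k => [|n IH] k.
  by rewrite qbinS sub0n mul1r (@qbin_small 0 k.+1)// mulr0.
have [nk|kn] := ltnP n k.
  by rewrite qbinS !(@qbin_small n.+1 k.+1)// mulr0 (eqP nk) mul1r.
rewrite qbinS {1}(IH k) subSn//; case: k kn => [|k] kn.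
  by rewrite !qbin0 subn0 qbinS qbin0 !exprS; ring.
rewrite {1}IH qbinS qbinS.
have -> : (n - k = (n - k.+1).+1)%N by lia.
have nE : (n = k.+1 + (n - k.+1))%N by lia.
move: (n - k.+1)%N nE => d nE; rewrite !exprS; ring.
Qed.

Lemma qbin_ratio n k :
  qbin n k.+1 * (1 - Q ^+ k.+1) = qbin n k * (1 - Q ^+ (n - k)).
Proof.
have := qbinS_dual n k; rewrite qbinS.
move: (qbin n k) (qbin n k.+1) (Q ^+ k.+1) (Q ^+ (n - k)) => x y a b H.
apply/eqP; rewrite -subr_eq0; apply/eqP.
have -> : y * (1 - a) - x * (1 - b) = b * x + y - (x + a * y) by ring.
by rewrite H subrr.
Qed.

Lemma qbin_middle n : 0 <= Q < 1 -> qbin n.*2.+1 n = qbin n.*2.+1 n.+1.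
Proof.
move=> /andP[Q0 Q1]; have := qbin_ratio n.*2.+1 n.
have -> : (n.*2.+1 - n = n.+1)%N by lia.
by move/mulIf => -> //; rewrite subr_eq0 eq_sym lt_eqF// exprn_ilt1.
Qed.

Lemma qbin_ge0 n k : 0 <= Q -> 0 <= qbin n k.
Proof.
by move=> Q0; elim: n k => [|n IH] [|k]//=; rewrite addr_ge0 ?mulr_ge0 ?exprn_ge0.
Qed.

Lemma qbin_le n k : 0 <= Q <= 1 -> qbin n k <= 2 ^+ n.
Proof.
move=> /andP[Q0 Q1]; elim: n k => [|n IH] [|k]//=; first by rewrite exprn_ege1// ler1n.
rewrite [2 ^+ _]exprS mulr_natl mulr2n lerD//; apply: le_trans (IH k.+1).
by rewrite ler_piMl ?qbin_ge0// exprn_ile1.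
Qed.

Arguments qbin : simpl never.

Definition theta_sign (s : nat) : F := (-1) ^+ s./2.

(** In terms of the bilateral index k, with [s = 2k+1] for [k >= 0] and
    [s = -2k] for [k < 0], this is (-1)^k Q^(3k^2 + k): the exponents are twice
    the generalized pentagonal numbers. *)
Definition theta_coef (s : nat) : F := theta_sign s * Q ^+ ('C(s, 2) + s./2 ^ 2).

Lemma theta_coef_odd s : odd s -> theta_coef s.+1 = - theta_coef s * Q ^+ (2 * s).
Proof.
move=> os; rewrite /theta_coef /theta_sign.
have hE : (s.+1)./2 = (s./2).+1.
  by rewrite -[in LHS](odd_double_half s) os add1n /= doubleK.
rewrite hE exprS mulN1r !mulNr -mulrA -exprD; congr (- (_ * _ ^+ _)).
rewrite binS bin1; have := odd_double_half s; rewrite os -mul2n; move: (s./2) => h.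
by move: ('C(s, 2)) => b; nia.
Qed.

Lemma theta_coef_even s : ~~ odd s -> theta_coef s.+1 = theta_coef s * Q ^+ s.
Proof.
move=> os; rewrite /theta_coef /theta_sign.
have hE : (s.+1)./2 = s./2.
  by rewrite -[in LHS](odd_double_half s) (negbTE os) add0n /= uphalf_double.
rewrite hE -mulrA -exprD; congr (_ * _ ^+ _).
by rewrite binS bin1; lia.
Qed.

(** Certificate for the step n to n+1 of [finite_theta]: the two Pascal rules,
    used alternately, leave terms that cancel between neighbouring values of
    the summation index. *)
Definition theta_cert n t : F :=
  if odd t then theta_coef t.+1 * (Q ^+ (n.+1 - t) * qbin n.*2.+2 (n + t).+1)
  else theta_coef t.+1 *
    (Q ^+ (n.+1 - t) * qbin n.*2.+1 (n + t) - Q ^+ n.+1 * qbin n.*2.+1 (n + t).+1).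

Lemma theta_certP n t : (t <= n.+1)%N ->
  theta_coef t.+1 *
    (qbin n.*2.+3 (n + t).+2 - (1 + Q ^+ n.+1) * qbin n.*2.+1 (n + t).+1)
  = theta_cert n t - theta_cert n t.+1.
Proof.
move=> tn.
(* At t = n+1 the exponent n - t is truncated, but it only multiplies Gaussian
   binomials that vanish. *)
have small1 : (n < t)%N -> qbin n.*2.+1 (n + t).+1 = 0 /\ qbin n.*2.+2 (n + t).+2 = 0.
  by move=> nt; rewrite !qbin_small//; lia.
have small2 : (n < t)%N -> qbin n.*2.+1 (n + t).+2 = 0.
  by move=> nt; rewrite qbin_small//; lia.
rewrite /theta_cert /= subSS addnS.
case ot : (odd t) => /=.
  rewrite (@theta_coef_even t.+1) /= ?ot//.
  rewrite qbinS_dual (qbinS n.*2.+1 (n + t).+1).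
  have -> : (n.*2.+2 - (n + t).+1 = n.+1 - t)%N by lia.
  have [nt|tn'] := ltnP n t.
    by have [-> _] := small1 nt; rewrite (small2 nt); ring.
  move: (n.+1 - t)%N (subSn tn') => _ ->.
  have nE : (n = t + (n - t))%N by lia.
  move: (n - t)%N nE => d nE.
  set x := qbin _ _; set y := qbin _ _; set z := qbin _ _; rewrite nE.
  rewrite !(exprS, exprD); ring.
rewrite (@theta_coef_odd t.+1) /= ?ot//.
rewrite (qbinS n.*2.+2 (n + t).+1) (qbinS_dual n.*2.+1 (n + t)).
have -> : (n.*2.+1 - (n + t) = n.+1 - t)%N by lia.
have [nt|tn'] := ltnP n t.
  by have [-> ->] := small1 nt; ring.
move: (n.+1 - t)%N (subSn tn') => _ ->.
have nE : (n = t + (n - t))%N by lia.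
move: (n - t)%N nE => d nE.
set x := qbin _ _; set y := qbin _ _; set z := qbin _ _; rewrite nE.
rewrite mul2n -addnn !(exprS, exprD); ring.
Qed.

(** A finite form of the pentagonal number theorem; letting n tend to infinity
    and multiplying by (1-Q)(1-Q^2)... gives the pentagonal number theorem in
    Q^2. *)
Lemma finite_theta n : 0 <= Q < 1 ->
  \sum_(1 <= s < n.+2) theta_coef s * qbin n.*2.+1 (n + s)
    = \prod_(1 <= i < n.+1) (1 + Q ^+ i).
Proof.
move=> Q01; elim: n => [|n IH].
  by rewrite big_nat1 big_geq// qbinn /theta_coef /theta_sign bin_small// !mulr1.
rewrite [RHS]big_nat_recr//= -IH mulr_suml.
rewrite doubleS.
have -> : \sum_(1 <= s < n.+2) theta_coef s * qbin n.*2.+1 (n + s) * (1 + Q ^+ n.+1)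
    = \sum_(1 <= s < n.+3) theta_coef s * qbin n.*2.+1 (n + s) * (1 + Q ^+ n.+1).
  rewrite [RHS]big_nat_recr//= qbin_small; last by lia.
  by rewrite mulr0 mul0r addr0.
apply/eqP; rewrite -subr_eq0 -sumrB big_add1 /=; apply/eqP.
transitivity (\sum_(0 <= t < n.+2) (theta_cert n t - theta_cert n t.+1)).
  rewrite [LHS]big_nat [RHS]big_nat; apply: eq_bigr => t /andP[_ tn].
  rewrite -theta_certP// !addSn !addnS; ring.
rewrite -[LHS]opprK -sumrN; under eq_bigr do rewrite opprB.
rewrite telescope_sumr//.
have -> : theta_cert n n.+2 = 0.
  rewrite /theta_cert !qbin_small; [|lia|lia|lia].
  by rewrite !mulr0 subrr mulr0 if_same.
have -> : theta_cert n 0 = 0.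
  rewrite /theta_cert /= addn0 subn0 -mulrBr.
  suff -> : qbin n.*2.+1 n = qbin n.*2.+1 n.+1 by rewrite subrr !mulr0.
  exact: qbin_middle.
by rewrite subr0 oppr0.
Qed.

Definition qpoch (q : F) n := \prod_(1 <= i < n.+1) (1 + q ^+ i).

Lemma qpochS q n : qpoch q n.+1 = qpoch q n * (1 + q ^+ n.+1).
Proof. by rewrite /qpoch big_nat_recr. Qed.

Lemma qpoch_ge1 q n : 0 <= q -> 1 <= qpoch q n.
Proof.
move=> q0; elim: n => [|n IH]; first by rewrite /qpoch big_geq.
by rewrite qpochS; have := exprn_ge0 n.+1 q0; nra.
Qed.
End QBinomial.

Arguments qbin : simpl never.

(** The identity [gauss_certP] with q^j = a, q^(N-j) = c and consecutive Gaussian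
    binomials x, y, z, whose ratios are given by the last two hypotheses. *)
Lemma gauss_certificate (F : fieldType) (a c q x y z P : F) :
    P != 0 -> 1 - c ^+ 2 * q ^+ 2 != 0 -> 1 - a ^+ 4 * c ^+ 2 * q ^+ 4 != 0 ->
    1 + a ^+ 2 * c ^+ 2 * q ^+ 2 != 0 -> 1 + a ^+ 2 * c ^+ 2 * q ^+ 3 != 0 ->
    y * (1 - a ^+ 4 * c ^+ 2 * q ^+ 2) = x * (1 - c ^+ 2 * q ^+ 2) ->
    z * (1 - a ^+ 4 * c ^+ 2 * q ^+ 4) = y * (1 - c ^+ 2) ->
  (1 + a ^+ 2 * q) * c * y / P -
  (1 + a ^+ 2 * q) * (q * c) *
    (x + a ^+ 4 * c ^+ 2 * q ^+ 2 * y
       + a ^+ 4 * c ^+ 2 * q ^+ 4 * (y + a ^+ 4 * c ^+ 2 * q ^+ 4 * z)) /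
    (P * (1 + a ^+ 2 * c ^+ 2 * q ^+ 2) * (1 + a ^+ 2 * c ^+ 2 * q ^+ 3))
  = c * (y - a ^+ 2 * q ^+ 2 * z) / (P * (1 + a ^+ 2 * c ^+ 2 * q ^+ 2))
    - q * c * (x - a ^+ 2 * y) / (P * (1 + a ^+ 2 * c ^+ 2 * q ^+ 2)).
Proof.
move=> P0 n1 n2 n3 n4 xE zE.
have -> : x = y * (1 - a ^+ 4 * c ^+ 2 * q ^+ 2) / (1 - c ^+ 2 * q ^+ 2).
  by rewrite xE mulfK.
have -> : z = y * (1 - c ^+ 2) / (1 - a ^+ 4 * c ^+ 2 * q ^+ 4).
  by rewrite -zE mulfK.
by field; move: n1 n2 n3 n4; rewrite P0 !exprMn => -> -> -> ->.
Qed.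

Section Theta.
Variables (F : realFieldType) (q : F).
Hypothesis q01 : 0 < q < 1.
Let Q := q ^+ 2.
Let b := qbin Q.
Let D := qpoch q.

(** The summand of the q-Gauss sum, normalized so that the full sum over [m] is 1
    for every [s > 0]; [m.+1] is the guaranteed part. *)
Definition gauss_term m s : F :=
  q ^+ (m.+1 - s) * (b m.*2.+1 (m + s) - Q ^+ s * b m.*2.+1 (m + s).+1) / D m.*2.+2.

(** Up to sign, the companion of [gauss_term] in a Wilf-Zeilberger pair; sums of it
    are the remainders of the partial sums. *)
Definition gauss_cert N j : F :=
  (1 + q ^+ (j.*2.+1)) * q ^+ (N - j) * b N.*2.+1 (N + j).+1 / D N.*2.+1.

(** The Wilf-Zeilberger equation: summed over [j] it gives the step from [N] to
    [N.+1] in [sum_gauss_term]. *)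
Lemma gauss_certP N j :
  gauss_cert N j - gauss_cert N.+1 j = gauss_term N j.+1 - gauss_term N j.
Proof.
have /andP[q0 q1] := q01.
have D0 n : D n != 0 by rewrite lt0r_neq0// (lt_le_trans ltr01)// qpoch_ge1// ltW.
have nz k : 1 + q ^+ k != 0 by rewrite lt0r_neq0// addr_gt0// exprn_gt0.
have nz' k : 1 - q ^+ k.+1 != 0 by rewrite subr_eq0 eq_sym lt_eqF// exprn_ilt1// ltW.
rewrite /gauss_cert /gauss_term.
have -> : (N.+1.*2.+1 = N.*2.+3)%N by lia.
rewrite /D !qpochS -/(D _) addSn addnS subSS.
(* For j > N+1 all terms vanish, and for j = N+1 only two of them remain, both
   with Gaussian binomial 1. *)
have [jN|] := leqP j N; last first.
  rewrite leq_eqVlt => /orP[/eqP <-|Nj]; last first.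
    by rewrite /b !qbin_small; (lia || ring).
  have -> : (N + N.+1 = N.*2.+1)%N by lia.
  have -> : (N - N.+1 = 0)%N by lia.
  have s1 : b N.*2.+1 N.*2.+2 = 0 by exact: qbin_small.
  have s2 : b N.*2.+1 N.*2.+3 = 0 by apply: qbin_small; lia.
  rewrite subnn s1 s2 /b !qbinn.
  rewrite -/(D N.*2.+1) doubleS.
  by field; rewrite D0 !nz.
have R1 := qbin_ratio Q N.*2.+1 (N + j); have R2 := qbin_ratio Q N.*2.+1 (N + j).+1.
rewrite -/b in R1 R2 *.
rewrite /b (qbinS _ N.*2.+2) (qbinS _ N.*2.+1) (qbinS _ N.*2.+1) -/b.
move: R1 R2; rewrite subSS.
set x := b _ (N + j)%N; set y := b _ (N + j).+1; set z := b _ (N + j).+2.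
have -> : (N.*2.+1 - (N + j) = (N - j).+1)%N by lia.
have -> : (N.*2 - (N + j) = N - j)%N by lia.
have -> : (N.+1 - j = (N - j).+1)%N by lia.
set d := (N - j)%N; set P := D _ * _.
have P0 : P != 0 by rewrite mulf_neq0.
have e1 : (N + j = j.*2 + d)%N by lia.
have e2 : (N.*2 = j.*2 + d.*2)%N by lia.
rewrite e1 e2 /Q => R1 R2.
have QE k : (q ^+ 2) ^+ k = (q ^+ k) ^+ 2 by rewrite -!exprM mulnC.
have h1 : q ^+ j.*2.+1 = (q ^+ j) ^+ 2 * q by rewrite exprSr -muln2 exprM.
have h3 k : (q ^+ 2) ^+ (j.*2 + d + k) = (q ^+ j) ^+ 4 * (q ^+ d) ^+ 2 * q ^+ (2 * k).
  by rewrite QE [q ^+ (2 * k)]exprM QE -muln2 !exprD exprM; ring.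
have h5 k : q ^+ (j.*2 + d.*2 + k) = (q ^+ j) ^+ 2 * (q ^+ d) ^+ 2 * q ^+ k.
  by rewrite -!muln2 !exprD !exprM.
have h7 k : (q ^+ 2) ^+ k.+1 = (q ^+ k) ^+ 2 * q ^+ 2 by rewrite exprSr QE.
move: R1 R2 (nz (j.*2 + d.*2 + 2)%N) (nz (j.*2 + d.*2 + 3)%N).
move: (nz' (2 * d + 1)%N) (nz' (j.*2.*2 + 2 * d + 3)%N).
have -> : ((2 * d + 1).+1 = 2 * d.+1)%N by lia.
have -> : ((j.*2.*2 + 2 * d + 3).+1 = 2 * (j.*2 + d + 2))%N by lia.
rewrite !(exprM _ 2) -[(j.*2 + d).+2]addn2 -[(j.*2 + d).+1]addn1.
rewrite -[(j.*2 + d.*2).+3]addn3 -[(j.*2 + d.*2).+2]addn2.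
rewrite !h3 !h5 h1 !h7 !QE [q ^+ d.+1]exprS !mulnS !muln0.
move=> n1 n2 R1 R2 n3 n4; exact: gauss_certificate.
Qed.

Lemma gauss_cert0 j : gauss_cert 0 j = (j == 0%N)%:R.
Proof.
have /andP[q0 q1] := q01.
rewrite /gauss_cert /b; case: j => [|j]; last by rewrite qbin_small// mulr0 mul0r.
rewrite qbinn /D /qpoch big_nat1 expr0 !mulr1 divff// lt0r_neq0//.
by rewrite expr1; lra.
Qed.

Lemma gauss_term0 m : gauss_term m 0 = 0.
Proof.
have /andP[q0 q1] := q01.
rewrite /gauss_term addn0 expr0 mul1r /b qbin_middle ?subrr ?mulr0 ?mul0r//.
by rewrite exprn_ge0 ?ltW// exprn_ilt1// ltW.
Qed.

(** By [gauss_certP] both sides have the same increments in [N], and at [N = 0]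
    the only nonzero remainder is the one for [j = 0], which is 1. *)
Lemma sum_gauss_term N s : (0 < s)%N ->
  \sum_(0 <= m < N) gauss_term m s = 1 - \sum_(0 <= j < s) gauss_cert N j.
Proof.
move=> s0; elim: N => [|N IH].
  rewrite big_geq// (big_cat_nat (n := 1))//= big_nat1 gauss_cert0.
  rewrite big_nat big1 ?addr0 ?subrr//.
  by move=> [|j]// _; rewrite gauss_cert0.
rewrite big_nat_recr//= {}IH.
have : \sum_(0 <= j < s) (gauss_cert N j - gauss_cert N.+1 j) = gauss_term N s.
  under eq_bigr do rewrite gauss_certP.
  by rewrite telescope_sumr// gauss_term0 subr0.
by rewrite sumrB => <-; ring.
Qed.

(** What multiplies the coefficient of index [s] once the numerators have been
    expanded by [finite_theta] and the two sums exchanged. *)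
Definition theta_tail N s : F :=
  \sum_(0 <= m < N) q ^+ m.+1 * b m.*2.+1 (m + s) / D m.*2.+2.

Lemma theta_tail_rec N s : (0 < s)%N ->
  theta_tail N s =
    q ^+ s * (1 - \sum_(0 <= j < s) gauss_cert N j) + Q ^+ s * theta_tail N s.+1.
Proof.
move=> s0; rewrite -sum_gauss_term// !mulr_sumr -big_split; apply: eq_bigr => m _ /=.
rewrite /gauss_term addnS.
have [sm|ms] := leqP s m.+1; last by rewrite /b !qbin_small; (lia || ring).
have -> : q ^+ m.+1 = q ^+ (m.+1 - s) * q ^+ s by rewrite -exprD subnK.
by ring.
Qed.

Lemma theta_tail_last N : theta_tail N N.+1 = 0.
Proof.
rewrite /theta_tail big_nat big1// => m /andP[_ mN].
by rewrite /b qbin_small ?mulr0 ?mul0r//; lia.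
Qed.

(** Iterating [theta_tail_rec] downwards from [s = N.+1], where the sum is empty;
    the exponents add up to squares because 2 'C(m, 2) + m = m^2. *)
Lemma theta_tailE N s : (0 < s <= N.+1)%N ->
  Q ^+ 'C(s, 2) * theta_tail N s =
    \sum_(s <= m < N.+1) q ^+ (m ^ 2) * (1 - \sum_(0 <= j < m) gauss_cert N j).
Proof.
move=> /andP[s0 sN]; rewrite -(subKn sN); have : (N.+1 - s < N.+1)%N by lia.
elim: (N.+1 - s)%N => [|d IH] dN.
  by rewrite subn0 big_geq// theta_tail_last mulr0.
have -> : (N.+1 - d.+1 = N - d)%N by lia.
have d1 : (N.+1 - d = (N - d).+1)%N by lia.
rewrite theta_tail_rec; last by lia.
rewrite [RHS]big_ltn; last by lia.
rewrite -d1 -IH; last by lia.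
have binq k : Q ^+ 'C(k, 2) * q ^+ k = q ^+ (k ^ 2).
  rewrite /Q -exprM -exprD; congr (q ^+ _).
  by elim: k => // k IHk; rewrite binS bin1 -(addn1 k) sqrnD; lia.
rewrite d1; move: (N - d)%N => k.
by rewrite mulrDr !mulrA binq -exprD binS bin1.
Qed.

(** The Hecke-type expansion, exact for each [N]: without the sums of
    [gauss_cert], which are O(q^(N+1)) after multiplication by [q ^+ (m ^ 2)],
    the right-hand side is a polynomial in q. *)
Lemma theta_identity N :
  \sum_(0 <= m < N) q ^+ m.+1 * (\prod_(1 <= i < m.+1) (1 + Q ^+ i)) / D m.*2.+2
  = \sum_(1 <= s < N.+1) theta_sign F s * Q ^+ (s./2 ^ 2) *
      \sum_(s <= m < N.+1) q ^+ (m ^ 2) * (1 - \sum_(0 <= j < m) gauss_cert N j).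
Proof.
have /andP[q0 q1] := q01.
have Q01 : 0 <= Q < 1 by rewrite exprn_ge0 ?ltW// exprn_ilt1// ltW.
transitivity (\sum_(1 <= s < N.+1) theta_coef Q s * theta_tail N s); last first.
  rewrite [LHS]big_nat [RHS]big_nat; apply: eq_bigr => s /andP[s0 sN].
  have sN' : (0 < s <= N.+1)%N by rewrite s0 ltnW.
  by rewrite -(theta_tailE sN') /theta_coef exprD [Q ^+ 'C(s, 2) * _]mulrC !mulrA.
under [RHS]eq_bigr do rewrite mulr_sumr.
rewrite exchange_big /= [LHS]big_nat [RHS]big_nat; apply: eq_bigr => m /andP[_ mN].
rewrite -(finite_theta m Q01) -/b.
rewrite [in RHS](big_cat_nat (n := m.+2))//=.
rewrite [X in _ = _ + X]big_nat [X in _ = _ + X]big1 ?addr0; last first.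
  by move=> s /andP[ms _]; rewrite /b qbin_small ?mulr0 ?mul0r ?mulr0//; lia.
by rewrite mulr_sumr mulr_suml; apply: eq_bigr => s _; ring.
Qed.

End Theta.

(** * Comparison of coefficients *)

Section Order.
Variable F : realFieldType.
Implicit Types (f g : F -> F) (p : {poly F}).

(** Vanishing to order [N] at 0, in a form that is uniform on the unit interval
    and hence stable under products with bounded functions. *)
Definition order_at0 N f :=
  exists K : F, forall x, 0 < x < 1 -> `|f x| <= K * x ^+ N.

Lemma eq_order N f g : (forall x, 0 < x < 1 -> f x = g x) ->
  order_at0 N f -> order_at0 N g.
Proof. by move=> fg [K fK]; exists K => x x01; rewrite -fg// fK. Qed.

Lemma orderD N f g : order_at0 N f -> order_at0 N g -> order_at0 N (fun x => f x + g x).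
Proof.
move=> [K fK] [L gL]; exists (K + L) => x x01; rewrite mulrDl.
by apply: le_trans (ler_normD _ _) _; rewrite lerD ?fK ?gL.
Qed.

Lemma orderM M N f g : order_at0 M f -> order_at0 N g ->
  order_at0 (M + N) (fun x => f x * g x).
Proof.
move=> [K fK] [L gL]; exists (K * L) => x x01.
by rewrite normrM exprD mulrACA ler_pM ?fK ?gL.
Qed.

Lemma order_weaken M N f : (M <= N)%N -> order_at0 N f -> order_at0 M f.
Proof.
move=> MN [K fK]; exists `|K| => x x01; apply: le_trans (fK x x01) _.
have /andP[x0 x1] := x01.
apply: (@le_trans _ _ (`|K| * x ^+ N)).
  by rewrite ler_wpM2r ?exprn_ge0 ?ler_norm// ltW.
by rewrite ler_wpM2l// ler_wiXn2l// ltW.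
Qed.

Lemma order0 N : order_at0 N (fun=> 0).
Proof. by exists 0 => x _; rewrite normr0 mul0r. Qed.

Lemma order_cst c : order_at0 0 (fun=> c).
Proof. by exists `|c| => x _; rewrite mulr1. Qed.

Lemma order_sum I (r : seq I) (P : pred I) N (f : I -> F -> F) :
  (forall i, P i -> order_at0 N (f i)) ->
  order_at0 N (fun x => \sum_(i <- r | P i) f i x).
Proof.
move=> fN; elim: r => [|i r IH].
  by apply: eq_order (order0 N) => x _; rewrite big_nil.
have [Pi|Pi] := boolP (P i).
  by apply: eq_order (orderD (fN i Pi) IH) => x _; rewrite big_cons Pi.
by apply: eq_order IH => x _; rewrite big_cons (negbTE Pi).
Qed.

Lemma order_prod I (r : seq I) (P : pred I) N (f g : I -> F -> F) :
  (forall i, P i -> order_at0 0 (f i)) -> (forall i, P i -> order_at0 0 (g i)) ->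
  (forall i, P i -> order_at0 N (fun x => f i x - g i x)) ->
  order_at0 N (fun x => \prod_(i <- r | P i) f i x - \prod_(i <- r | P i) g i x).
Proof.
move=> f0 g0 fgN.
have bounded (h : I -> F -> F) s : (forall i, P i -> order_at0 0 (h i)) ->
    order_at0 0 (fun x => \prod_(i <- s | P i) h i x).
  move=> h0; elim: s => [|i s IH].
    by apply: eq_order (order_cst 1) => x _; rewrite big_nil.
  have [Pi|Pi] := boolP (P i).
    by apply: eq_order (orderM (h0 i Pi) IH) => x _; rewrite big_cons Pi.
  by apply: eq_order IH => x _; rewrite big_cons (negbTE Pi).
elim: r => [|i r IH].
  by apply: eq_order (order0 N) => x _; rewrite !big_nil subrr.
have [Pi|Pi] := boolP (P i); last first.
  by apply: eq_order IH => x _; rewrite !big_cons (negbTE Pi).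
have A := orderM (fgN i Pi) (bounded f r f0).
have B := orderM (g0 i Pi) IH.
rewrite addn0 in A; apply: eq_order (orderD A B) => x _.
by rewrite !big_cons Pi; ring.
Qed.

Lemma order_poly p : order_at0 0 (fun x => p.[x]).
Proof.
apply: eq_order (order_sum (index_enum 'I_(size p)) (P := xpredT) (N := 0)
  (f := fun i x => p`_i * x ^+ i) _).
  by move=> x _; rewrite horner_coef.
move=> i _; exists `|p`_i| => x /andP[x0 x1].
rewrite normrM expr0 mulr1 (ger0_norm (exprn_ge0 _ (ltW x0))) ler_piMr//.
by rewrite exprn_ile1 ?ltW.
Qed.

(** The constant coefficient is O(x) for every x in the unit interval, hence zero;
    then divide by x and repeat. *)
Lemma order_coef N p i : order_at0 N (fun x => p.[x]) -> (i < N)%N -> p`_i = 0.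
Proof.
elim: N p i => // N IH p i [K pK].
have [L pL] := order_poly (drop_poly 1 p).
have pE x : p.[x] = p`_0 + x * (drop_poly 1 p).[x].
  have := poly_take_drop 1 p => /(congr1 (fun r => r.[x])) <-.
  rewrite hornerD hornerM hornerXn mulrC expr1; congr (_ + _).
  rewrite (_ : take_poly 1 p = (p`_0)%:P) ?hornerC//.
  by apply/polyP => -[|j]; rewrite coef_take_poly coefC.
have p0 : p`_0 = 0.
  apply/eqP; rewrite -normr_le0; apply/ler_addgt0Pr => e e0; rewrite add0r.
  pose C := `|K| + `|L| + 1.
  have C0 : 0 < C by have := normr_ge0 K; have := normr_ge0 L; rewrite /C; lra.
  pose x := Num.min (2^-1) (e / C).
  have x0 : 0 < x by rewrite lt_min invr_gt0 ltr0n divr_gt0.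
  have x1 : x < 1 by rewrite gt_min invf_lt1// ltr1n.
  have xC : C * x <= e by rewrite mulrC -ler_pdivlMr// ge_min lexx orbT.
  have x01 : 0 < x < 1 by rewrite x0.
  have := pK x x01; have := pL x x01; rewrite mulr1 => Lx.
  have : K * x ^+ N.+1 <= `|K| * x.
    apply: (@le_trans _ _ (`|K| * x ^+ N.+1)).
      by rewrite ler_wpM2r ?exprn_ge0 ?ler_norm// ltW.
    by rewrite ler_wpM2l// exprS ler_piMr ?exprn_ile1// ltW.
  have : `|x * (drop_poly 1 p).[x]| <= `|L| * x.
    rewrite normrM (gtr0_norm x0) mulrC ler_wpM2r ?(ltW x0)//.
    exact: le_trans Lx (ler_norm _).
  move: xC; rewrite pE /C; move: (x * _) => y.
  have := ler_normB (p`_0 + y) y; rewrite addrK; lra.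
case: i => [|i]//; rewrite ltnS => iN.
have -> : p`_i.+1 = (drop_poly 1 p)`_i by rewrite coef_drop_poly addn1.
apply: (IH _ _ _ iN); exists K => x x01; have /andP[x0 _] := x01.
have := pK x x01; rewrite pE p0 add0r normrM (gtr0_norm x0) exprS mulrCA.
by rewrite ler_pM2l.
Qed.

Definition theta_partial N : {poly int} :=
  \sum_(1 <= s < N.+1) \sum_(s <= m < N.+1)
    (-1) ^+ s./2 *: 'X^(m ^ 2 + 2 * s./2 ^ 2).

Definition ev (p : {poly int}) (x : F) : F := (map_poly intr p).[x].

Lemma ev_theta N x : ev (theta_partial N) x =
  \sum_(1 <= s < N.+1) \sum_(s <= m < N.+1)
    theta_sign F s * (x ^+ 2) ^+ (s./2 ^ 2) * x ^+ (m ^ 2).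
Proof.
rewrite /ev /theta_partial rmorph_sum horner_sum; apply: eq_bigr => s _.
rewrite rmorph_sum horner_sum; apply: eq_bigr => m _.
rewrite /= map_polyZ map_polyXn /= hornerZ hornerXn /theta_sign.
by rewrite rmorphXn rmorphN1 -mulrA -exprM -exprD addnC.
Qed.

(** A remainder in [theta_identity] carries q^(m^2 + N - j) with j < m <= m^2, and
    its other factors are bounded on the unit interval. *)
Lemma theta_order N : order_at0 N.+1 (fun q =>
  \sum_(0 <= m < N) q ^+ m.+1 * (\prod_(1 <= i < m.+1) (1 + q ^+ 2 ^+ i))
     / qpoch q m.*2.+2 - ev (theta_partial N) q).
Proof.
apply: (@eq_order _ (fun q => \sum_(1 <= s < N.+1 | (0 < s)%N)
    \sum_(s <= m < N.+1 | (m < N.+1)%N) \sum_(0 <= j < m | (j < m)%N)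
    - (theta_sign F s * (q ^+ 2) ^+ (s./2 ^ 2) * q ^+ (m ^ 2) * gauss_cert q N j))).
  move=> q q01; rewrite (theta_identity q01) ev_theta.
  rewrite -sumrB [RHS]big_nat_cond [LHS]big_nat_cond.
  apply: eq_big => [s|s /andP[/andP[s0 _] _]].
    by case: (0 < s)%N => //=; rewrite !andbT.
  rewrite mulr_sumr -sumrB [RHS]big_nat_cond [LHS]big_nat_cond.
  apply: eq_big => [m|m _]; first by case: (m < N.+1)%N; rewrite ?andbF ?andbT.
  rewrite mulrA mulrBr mulr1 addrAC subrr add0r mulr_sumr -sumrN.
  rewrite [RHS]big_nat_cond [LHS]big_nat_cond; apply: eq_bigl => j.
  by case: (j < m)%N; rewrite ?andbF ?andbT.
apply: order_sum => s _; apply: order_sum => m mN; apply: order_sum => j jm.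
(* 2 for the factor 1 + q^(2j+1) and 2^(2N+1) for the Gaussian binomial. *)
exists (2 ^+ N.*2.+2) => q q01; have /andP[q0 q1] := q01.
have q0' := ltW q0; have q1' := ltW q1.
have Q01 : 0 <= q ^+ 2 <= 1 by rewrite exprn_ge0 ?exprn_ile1.
have /andP[Q0 Q1] := Q01.
rewrite normrN 3!normrM /theta_sign normrX normrN1 expr1n mul1r.
rewrite (ger0_norm (exprn_ge0 _ q0')) (ger0_norm (exprn_ge0 _ Q0)).
have b1 : `|1 + q ^+ j.*2.+1| <= 2.
  by rewrite ger0_norm ?addr_ge0 ?exprn_ge0// -[leRHS]/(1 + 1) lerD2l exprn_ile1.
have b2 : `|qbin (q ^+ 2) N.*2.+1 (N + j).+1| <= 2 ^+ N.*2.+1.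
  by rewrite ger0_norm ?qbin_ge0// qbin_le.
have b3 : `|qpoch q N.*2.+1|^-1 <= 1.
  have h1 := @qpoch_ge1 _ q N.*2.+1 q0'.
  by rewrite invf_le1 ger0_norm// (lt_le_trans ltr01, le_trans ler01).
have b4 : (q ^+ 2) ^+ (s./2 ^ 2) <= 1 by rewrite exprn_ile1.
have b5 : q ^+ (m ^ 2) * `|q ^+ (N - j)| <= q ^+ N.+1.
  rewrite ger0_norm ?exprn_ge0// -exprD ler_wiXn2l//.
  by move: jm mN; rewrite expnS expn1; nia.
rewrite /gauss_cert 3!normrM normfV.
apply: (@le_trans _ _ (1 * (2 * 2 ^+ N.*2.+1 * q ^+ N.+1))); last first.
  by rewrite mul1r -exprS.
set u := `|1 + _|; set v := `|q ^+ _|; set w := `|qbin _ _ _|; set z := _^-1.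
have -> : (q ^+ 2) ^+ (s./2 ^ 2) * q ^+ (m ^ 2) * (u * v * w * z)
  = (q ^+ 2) ^+ (s./2 ^ 2) * (u * w * (q ^+ (m ^ 2) * v) * z) by ring.
have u0 : 0 <= u by exact: normr_ge0.
have v0 : 0 <= v by exact: normr_ge0.
have w0 : 0 <= w by exact: normr_ge0.
have z0 : 0 <= z by rewrite invr_ge0.
have qm0 : 0 <= q ^+ (m ^ 2) by rewrite exprn_ge0.
apply: ler_pM => //; rewrite ?exprn_ge0 ?mulr_ge0//.
rewrite -[leRHS]mulr1; apply: ler_pM => //; first by rewrite !mulr_ge0.
by apply: ler_pM => //; rewrite ?mulr_ge0// ler_pM.
Qed.

Lemma ev_signed_geom B k x :
  ev (signed_geom B k) x * (1 + x ^+ k) = 1 - (- x ^+ k) ^+ B.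
Proof.
have -> : ev (signed_geom B k) x = \sum_(i < B) (- x ^+ k) ^+ i.
  rewrite /ev /signed_geom rmorph_sum horner_sum; apply: eq_bigr => i _.
  by rewrite rmorphXn rmorphN /= map_polyXn horner_exp hornerN hornerXn.
by have := subrX1 (- x ^+ k) B; lra.
Qed.

Lemma order_signed_geom B k : (0 < k)%N ->
  order_at0 B (fun x => ev (signed_geom B k) x - (1 + x ^+ k)^-1).
Proof.
move=> k0; exists 1 => x /andP[x0 x1].
have d1 : 1 <= 1 + x ^+ k by rewrite lerDl exprn_ge0// ltW.
have d0 : 0 < 1 + x ^+ k by apply: lt_le_trans d1.
have -> : ev (signed_geom B k) x - (1 + x ^+ k)^-1 = - (- x ^+ k) ^+ B / (1 + x ^+ k).
  apply: (mulIf (lt0r_neq0 d0)); rewrite mulrBl ev_signed_geom divfK ?lt0r_neq0//.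
  by rewrite mulVf ?lt0r_neq0//; ring.
rewrite normrM normrN normrX normrN normfV (gtr0_norm d0).
rewrite (ger0_norm (exprn_ge0 _ (ltW x0))).
rewrite mul1r ler_pdivrMr//; apply: (@le_trans _ _ (x ^+ B)).
  by rewrite -exprM ler_wiXn2l ?leq_pmull// ltW.
by rewrite ler_peMr// exprn_ge0// ltW.
Qed.

Lemma order_parts_poly B l : (0 < l)%N -> order_at0 B (fun x =>
  ev (parts_poly B l) x - \prod_(k < B | allowed_part l k) (1 + x ^+ k)^-1).
Proof.
move=> l0.
have kpos (k : 'I_B) : allowed_part l k -> (0 < k)%N.
  by case/orP => [/andP[/odd_gt0]//|/eqP ->]; rewrite muln_gt0.
apply: (@eq_order _ (fun x => \prod_(k < B | allowed_part l k) ev (signed_geom B k) x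
    - \prod_(k < B | allowed_part l k) (1 + x ^+ k)^-1)).
  by move=> x _; rewrite /ev /parts_poly rmorph_prod horner_prod.
apply: order_prod => k al.
- exact: order_poly.
- exists 1 => x /andP[x0 x1]; rewrite mulr1 normfV.
  have h : 1 <= 1 + x ^+ k by rewrite lerDl exprn_ge0// ltW.
  by rewrite invf_le1 ger0_norm// (lt_le_trans ltr01, le_trans ler01).
- exact/order_signed_geom/kpos.
Qed.

Lemma prod_allowed_part (G : nat -> F) B l : (0 < l)%N -> (2 * l < B)%N ->
  \prod_(k < B | allowed_part l k) G k = G (2 * l)%N * \prod_(0 <= i < l) G (2 * i).+1.
Proof.
move=> l0 lB; rewrite -(big_mkord (allowed_part l) G) -big_filter.
rewrite (perm_big ((2 * l)%N :: [seq (2 * i).+1 | i <- iota 0 l])).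
  by rewrite big_cons big_map /index_iota subn0.
apply: uniq_perm.
- exact/filter_uniq/iota_uniq.
- rewrite /= map_inj_uniq ?iota_uniq ?andbT; last by move=> i j; lia.
  by apply/mapP => -[i _]; lia.
- move=> k; rewrite mem_filter mem_index_iota inE /allowed_part.
  apply/andP/orP => [[/orP[/andP[ok kl]|/eqP ->] _]|[/eqP ->|/mapP[i]]].
  + right; apply/mapP; exists k./2; first by rewrite mem_iota; lia.
    by have := odd_double_half k; rewrite ok; lia.
  + by left.
  + by rewrite eqxx orbT lB.
  + rewrite mem_iota => /andP[_ il] ->; rewrite mul2n /= odd_double /=; lia.
Qed.

Lemma qpoch_split (q : F) m : qpoch q m.*2.+2 =
  \prod_(0 <= i < m.+1) (1 + q ^+ (2 * i).+1) *
  \prod_(1 <= i < m.+2) (1 + (q ^+ 2) ^+ i).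
Proof.
elim: m => [|m IH].
  by rewrite /qpoch !big_nat1 big_nat_recr//= big_nat1 muln0 !expr1.
rewrite doubleS qpochS qpochS IH [X in _ = X * _]big_nat_recr//=.
rewrite [X in _ = _ * X]big_nat_recr//=.
rewrite -exprM; have -> : (2 * m.+1 = m.*2.+2)%N by lia.
have -> : (2 * m.+2 = m.*2.+4)%N by lia.
ring.
Qed.

(** The l-th product is within O(x^(2N+1)) of the reciprocal of
    (1+x)(1+x^3)...(1+x^(2l-1))(1+x^(2l)), and multiplying numerator and
    denominator by (1+x^2)...(1+x^(2l-2)) gives the summand of
    [theta_identity]. *)
Lemma order_p2_theta N : order_at0 N.+1 (fun x =>
  ev (\sum_(1 <= l < N.+1) 'X^l * parts_poly N.*2.+1 l - theta_partial N) x).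
Proof.
have NB : (N.+1 <= N.*2.+1)%N by lia.
have tO := theta_order N.
pose err l x := ev (parts_poly N.*2.+1 l) x
  - \prod_(k < N.*2.+1 | allowed_part l k) (1 + x ^+ k)^-1.
have pO : order_at0 N.+1 (fun x => \sum_(1 <= l < N.+1 | (0 < l)%N) x ^+ l * err l x).
  apply: order_sum => l l0; have eO := order_weaken NB (order_parts_poly N.*2.+1 l0).
  have xO : order_at0 0 (fun x : F => x ^+ l).
    by apply: eq_order (order_poly 'X^l) => x _; rewrite hornerXn.
  exact: (orderM xO eO).
apply: eq_order (orderD pO tO) => x /andP[x0 x1].
rewrite /ev rmorphB hornerD hornerN addrA; congr (_ - _).
rewrite rmorph_sum horner_sum.
rewrite (_ : \sum_(1 <= l < N.+1 | (0 < l)%N) x ^+ l * err l x =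
             \sum_(1 <= l < N.+1) x ^+ l * err l x); last first.
  rewrite big_nat_cond [RHS]big_nat_cond; apply: eq_bigl => l.
  by case: (0 < l)%N => //=; rewrite !andbT.
rewrite [X in _ + X](_ : _ = \sum_(1 <= l < N.+1)
    x ^+ l * \prod_(k < N.*2.+1 | allowed_part l k) (1 + x ^+ k)^-1).
  rewrite -big_split/=; apply: eq_bigr => l _.
  by rewrite -mulrDr subrK rmorphM hornerM /= map_polyXn hornerXn.
rewrite big_add1/= [LHS]big_nat [RHS]big_nat; apply: eq_bigr => m /andP[_ mN].
have -> : \prod_(k < N.*2.+1 | allowed_part m.+1 k) (1 + x ^+ k)^-1
        = (1 + x ^+ (2 * m.+1))^-1 * \prod_(0 <= i < m.+1) (1 + x ^+ (2 * i).+1)^-1.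
  by rewrite (prod_allowed_part (fun k => (1 + x ^+ k)^-1))//; lia.
rewrite qpoch_split [\prod_(1 <= i < m.+2) _]big_nat_recr//= prodfV exprM.
have pos (a b : nat) (G : nat -> F) :
    (forall i, 0 < G i) -> \prod_(a <= i < b) G i != 0.
  by move=> G0; apply/lt0r_neq0/prodr_gt0.
have xpos k : 0 < 1 + x ^+ k by rewrite addr_gt0// exprn_gt0.
have A0 := pos 0%N m.+1 (fun i => 1 + x ^+ (2 * i).+1) (fun i => xpos _).
have C0 : \prod_(1 <= i < m.+1) (1 + (x ^+ 2) ^+ i) != 0.
  by apply: pos => i; rewrite -exprM.
have d0 : 1 + (x ^+ 2) ^+ m.+1 != 0 by rewrite -exprM lt0r_neq0.
move: A0 C0 d0; set A := \prod_(0 <= i < _) _; set C := \prod_(1 <= i < _) _.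
move: (1 + _ ^+ m.+1) => d A0 C0 d0; move: (x ^+ m.+1) => y.
by field; rewrite A0 C0 d0.
Qed.

End Order.

(** By [order_p2_theta] the two sides are coefficients of polynomials whose difference
    is O(x^(n+1)). *)
Lemma p2_theta n : p2 n = \sum_(1 <= s < n.+1)
  \sum_(s <= m < n.+1 | (m ^ 2 + 2 * s./2 ^ 2 == n)%N) (-1) ^+ s./2.
Proof.
(* The truncation must exceed 2 l for every l <= n, so that no factor of the
   product over the allowed parts is lost. *)
rewrite (@p2_coef n.*2.+1 n n); last by lia.
set P := \sum_(1 <= l < n.+1) _.
transitivity ((theta_partial n)`_n).
  apply/eqP; rewrite -subr_eq0 -coefB; apply/eqP.
  have := order_coef (order_p2_theta rat n) (ltnSn n).
  by rewrite coef_map /= => /eqP; rewrite intr_eq0 => /eqP.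
rewrite coef_sum; apply: eq_bigr => s _; rewrite coef_sum [RHS]big_mkcond.
by apply: eq_bigr => m _; rewrite coefZ coefXn eq_sym; case: eqP; rewrite ?mulr1 ?mulr0.
Qed.

Lemma p2_gt0_quadratic_form n : 0 < p2 n -> exists x y, n = (x ^ 2 + 2 * y ^ 2)%N.
Proof.
rewrite p2_theta; have [/existsP[s /existsP[m /eqP <-]] _|none] :=
  boolP [exists s : 'I_n.+1, exists m : 'I_n.+1, (m ^ 2 + 2 * s./2 ^ 2 == n)%N].
  by exists m, s./2.
rewrite big_nat big1 ?ltxx// => s /andP[_ sn].
rewrite big_nat_cond big1// => m /andP[/andP[_ mn] mE]; exfalso.
move/negP: none; apply; apply/existsP; exists (Ordinal sn).
by apply/existsP; exists (Ordinal mn).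
Qed.

(** Each pair (s, m) contributes to one value of i only, and m^2 <= n forces
    s <= m <= sqrt n. *)
Lemma sum_abs_p2_le n : \sum_(1 <= i < n.+1) `|p2 i| <= n%:R.
Proof.
have [K /andP[Kn nK]] := floor_sqrt n.
have ptw i : (1 <= i < n.+1)%N -> `|p2 i| <=
    \sum_(1 <= s < K.+1) \sum_(1 <= m < K.+1) (m ^ 2 + 2 * s./2 ^ 2 == i)%N%:R.
  move=> /andP[i0 iltn]; rewrite p2_theta.
  apply: le_trans (ler_norm_sum _ _ _) _.
  have Kn' : (K.+1 <= n.+1)%N by rewrite ltnS (leq_trans _ Kn)// expnS expn1; nia.
  rewrite (big_nat_widen 1 _ n.+1)// [leRHS](big_nat_widen 1 _ n.+1)//=.
  rewrite big_mkcond [leRHS]big_mkcond /= big_nat [leRHS]big_nat.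
  apply: ler_sum => s /andP[s0 sn].
  have pos : 0 <= \sum_(1 <= m < K.+1) (m ^ 2 + 2 * s./2 ^ 2 == i)%N%:R :> int.
    by apply: sumr_ge0.
  case: ifP => si; last by case: ifP.
  apply: le_trans (ler_norm_sum _ _ _) _.
  rewrite (big_nat_widenl s 1)// (big_nat_widen 1 _ n.+1)//.
  case: ifP => sK; last first.
    rewrite big_nat_cond big1// => m /andP[/andP[m0 mn] /andP[/andP[/eqP mE sm] mi]].
    exfalso; move: nK; rewrite ltnNge => /negP; apply.
    apply: (@leq_trans (m ^ 2)); first by rewrite leq_sqr; lia.
    by rewrite -ltnS; apply: leq_trans iltn; rewrite ltnS -mE leq_addr.
  rewrite [leRHS](big_nat_widen 1 _ n.+1)// big_mkcond [leRHS]big_mkcond /=.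
  apply: ler_sum => m _; case: ifP => [/andP[/andP[mE sm] mi]|_]; last by case: ifP.
  have mK : (m < K.+1)%N.
    rewrite -ltn_sqr; apply: leq_ltn_trans nK.
    by rewrite -ltnS; apply: leq_trans iltn; rewrite ltnS -(eqP mE) leq_addr.
  by rewrite mK mE normrX normrN1 expr1n.
apply: le_trans (ler_sum_nat ptw) _.
rewrite exchange_big /=.
apply: (@le_trans _ _ (\sum_(1 <= s < K.+1) \sum_(1 <= m < K.+1) 1)).
  apply: ler_sum => s _; rewrite exchange_big /=; apply: ler_sum => m _.
  rewrite -natr_sum -[1]/(1%:R) ler_nat.
  have [j|none] := boolP (has (pred1 (m ^ 2 + 2 * s./2 ^ 2)%N) (index_iota 1 n.+1)).
    have jin : (m ^ 2 + 2 * s./2 ^ 2)%N \in index_iota 1 n.+1.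
      by case/hasP: j => j jin /eqP <-.
    rewrite (bigD1_seq _ jin) ?iota_uniq//= eqxx big1// => k /negbTE.
    by rewrite eq_sym => ->.
  rewrite big_seq big1// => k kin; apply/eqP; rewrite eqb0.
  by apply: contra none => /eqP E; apply/hasP; exists k => //=; rewrite E.
rewrite !big_const_nat !iter_addr_0 !subn1 /= -mulrnA -mulnn in Kn *.
by rewrite ler_nat.
Qed.

(** * Divisor sums and a character modulo 8 *)

Lemma sum_multiples (R : nmodType) (g : nat -> R) (d Y : nat) : (0 < d)%N ->
  \sum_(1 <= n < Y.+1 | (d %| n)%N) g (n %/ d)%N
    = \sum_(1 <= e < (Y %/ d).+1) g e.
Proof.
move=> d0; rewrite -big_filter.
rewrite (perm_big [seq (d * e)%N | e <- index_iota 1 (Y %/ d).+1]).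
  by rewrite big_map; apply: eq_bigr => e _; rewrite mulKn.
apply: uniq_perm; first exact/filter_uniq/iota_uniq.
  rewrite map_inj_uniq ?iota_uniq// => x y /eqP.
  by rewrite eqn_pmul2l// => /eqP.
move=> n; rewrite mem_filter mem_index_iota.
apply/andP/mapP => [[/dvdnP[e ->] /andP[n1]]|[e]].
  rewrite ltnS => nY; exists e; last by rewrite mulnC.
  by rewrite mem_index_iota ltnS leq_divRL// nY andbT; case: e n1 {nY}.
rewrite mem_index_iota ltnS leq_divRL// => /andP[e1 eY] ->.
by rewrite dvdn_mulr// muln_gt0 d0 e1 ltnS mulnC.
Qed.

Lemma sum_divisorsE (R : nmodType) (g : nat -> R) (n Y : nat) :
  (0 < n <= Y)%N ->
  \sum_(d <- divisors n) g d = \sum_(1 <= d < Y.+1 | (d %| n)%N) g d.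
Proof.
move=> /andP[n0 nY]; rewrite -[RHS]big_filter; apply: perm_big.
apply: uniq_perm; rewrite ?divisors_uniq//; first exact/filter_uniq/iota_uniq.
move=> d; rewrite -dvdn_divisors// mem_filter mem_index_iota.
case dn : (d %| n)%N => //=; rewrite ltnS (leq_trans (dvdn_leq n0 dn))//.
by rewrite (dvdn_gt0 n0).
Qed.

(** Both sides sum [f d e] over the pairs with d e <= Y. *)
Lemma hyperbola (R : nmodType) (f : nat -> nat -> R) (Y : nat) :
  \sum_(1 <= n < Y.+1) \sum_(d <- divisors n) f d (n %/ d)%N
    = \sum_(1 <= d < Y.+1) \sum_(1 <= e < (Y %/ d).+1) f d e.
Proof.
transitivity (\sum_(1 <= n < Y.+1) \sum_(1 <= d < Y.+1 | (d %| n)%N)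
                 f d (n %/ d)%N).
  rewrite [LHS]big_nat [RHS]big_nat; apply: eq_bigr => n.
  by rewrite ltnS => nY; apply: sum_divisorsE.
rewrite (exchange_big_dep xpredT)//= [LHS]big_nat [RHS]big_nat.
by apply: eq_bigr => d /andP[d0 _]; rewrite -sum_multiples.
Qed.

Lemma perm_divisorsM (p k m : nat) :
    prime p -> (0 < m)%N -> ~~ (p %| m)%N ->
  perm_eq (divisors (p ^ k * m))
          [seq (p ^ i * d)%N | i <- iota 0 k.+1, d <- divisors m].
Proof.
move=> pp m0 pm; have p0 := prime_gt0 pp.
have cop d : (d %| m)%N -> coprime p d.
  move=> dm; rewrite prime_coprime//.
  by apply: contra pm => /dvdn_trans; exact.
have lognE i d : (d %| m)%N -> logn p (p ^ i * d) = i.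
  move=> dm; rewrite lognM ?expn_gt0 ?p0 ?(dvdn_gt0 m0)//.
  by rewrite pfactorK// logn_coprime ?cop// addn0.
apply: uniq_perm; first exact: divisors_uniq.
  apply: allpairs_uniq; rewrite ?iota_uniq ?divisors_uniq//.
  move=> x y /allpairsPdep[i1 [d1 [_ d1m ->]]].
  move=> /allpairsPdep[j1 [e1 [_ e1m ->]]] /= eqE.
  move: d1m e1m; rewrite -!dvdn_divisors// => d1m e1m.
  have ij : i1 = j1 by rewrite -(lognE i1 d1 d1m) eqE lognE.
  move: eqE; rewrite ij => /eqP; rewrite eqn_pmul2l ?expn_gt0 ?p0//.
  by move=> /eqP ->.
move=> n; rewrite -dvdn_divisors ?muln_gt0 ?expn_gt0 ?p0//.
apply/idP/allpairsP => [npm|[[i d] [+ + ->]]]; last first.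
  rewrite mem_iota -dvdn_divisors// add0n ltnS => /andP[_ /= ik] dm.
  by rewrite dvdn_mul// dvdn_exp2l.
have n0 : (0 < n)%N by rewrite (dvdn_gt0 _ npm)// muln_gt0 expn_gt0 p0.
have [d nd nE] := pfactor_coprime pp n0.
exists (logn p n, d); split; last by rewrite mulnC.
  rewrite mem_iota add0n ltnS /=.
  rewrite -[leqRHS](lognE k m (dvdnn m)); apply: dvdn_leq_log => //.
  by rewrite muln_gt0 expn_gt0 p0.
rewrite -dvdn_divisors//.
have : (d %| p ^ k * m)%N.
  by apply: dvdn_trans npm; rewrite [X in (_ %| X)%N]nE dvdn_mulr.
by rewrite Gauss_dvdr// coprime_sym coprimeXl.
Qed.

Lemma hyperbola_swap (R : nmodType) (f : nat -> nat -> R) (Y : nat) :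
  \sum_(1 <= d < Y.+1) \sum_(1 <= e < (Y %/ d).+1) f d e
    = \sum_(1 <= e < Y.+1) \sum_(1 <= d < (Y %/ e).+1) f d e.
Proof.
have restrict (g : nat -> R) d : (0 < d)%N ->
    \sum_(1 <= e < (Y %/ d).+1) g e = \sum_(1 <= e < Y.+1 | (d * e <= Y)%N) g e.
  move=> d0; rewrite [RHS](big_cat_nat (n := (Y %/ d).+1))//=; last first.
    by rewrite ltnS leq_div.
  rewrite [X in _ = _ + X]big_nat_cond [X in _ = _ + X]big1 ?addr0; last first.
    by move=> e /andP[/andP[+ _] +]; rewrite ltn_divLR// mulnC ltnNge => /negbTE ->.
  rewrite big_nat_cond [RHS]big_nat_cond; apply: eq_bigl => e.
  by rewrite andbT; case: andP => //= -[_]; rewrite ltnS leq_divRL// mulnC => ->.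
transitivity (\sum_(1 <= d < Y.+1) \sum_(1 <= e < Y.+1 | (d * e <= Y)%N) f d e).
  rewrite [LHS]big_nat [RHS]big_nat.
  by apply: eq_bigr => d /andP[d0 _]; rewrite restrict.
rewrite (exchange_big_dep xpredT)//= [LHS]big_nat [RHS]big_nat.
apply: eq_bigr => e /andP[e0 _]; rewrite restrict//.
by apply: eq_bigl => d; rewrite mulnC.
Qed.

(** The Kronecker symbol of the field of discriminant -8. *)
Definition chi (n : nat) : int :=
  match (n %% 8)%N with 1 | 3 => 1 | 5 | 7 => -1 | _ => 0 end.

Lemma chi_mod n : chi (n %% 8) = chi n.
Proof. by rewrite /chi modn_mod. Qed.

Lemma chiM : {morph chi : a b / (a * b)%N >-> a * b}.
Proof.
move=> a b; rewrite -(chi_mod (a * b)) -modnMm chi_mod -(chi_mod a) -(chi_mod b).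
have := ltn_pmod a (isT : 0 < 8)%N; have := ltn_pmod b (isT : 0 < 8)%N.
by move: (b %% 8)%N (a %% 8)%N; do 8?[case=> //]; do 8?[case=> //].
Qed.

Lemma chiX a k : chi (a ^ k) = chi a ^+ k.
Proof. by elim: k => [|k IH]; rewrite ?expn0// expnS chiM IH exprS. Qed.

Lemma chi_cases n : [\/ chi n = 1, chi n = 0 | chi n = -1].
Proof.
rewrite /chi; have := ltn_pmod n (isT : 0 < 8)%N.
by case: (n %% 8)%N => [|[|[|[|[|[|[|[|k]]]]]]]] //; constructor.
Qed.

Lemma chi_sum n : 0 <= \sum_(1 <= i < n.+1) chi i <= 2.
Proof.
suff : \sum_(1 <= i < n.+1) chi i
       = nth 0 [:: 0; 1; 1; 2; 2; 1; 1; 0] (n %% 8).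
  move=> ->; have := ltn_pmod n (isT : 0 < 8)%N.
  by case: (n %% 8)%N => [|[|[|[|[|[|[|[|k]]]]]]]].
elim: n => [|n IH]; first by rewrite big_geq.
rewrite big_nat_recr//= {}IH -chi_mod -(addn1 n) -modnDml.
have := ltn_pmod n (isT : 0 < 8)%N.
by case: (n %% 8)%N => [|[|[|[|[|[|[|[|k]]]]]]]].
Qed.

Lemma prime_power_split n : (1 < n)%N ->
  exists p k m, [/\ prime p, (0 < m < n)%N, ~~ (p %| m)%N, (0 < k)%N
                  & n = (p ^ k * m)%N].
Proof.
move=> n1; have n0 := ltnW n1; have pp := pdiv_prime n1.
have [m pm nE] := pfactor_coprime pp n0.
exists (pdiv n), (logn (pdiv n) n), m.
have k0 : (0 < logn (pdiv n) n)%N by rewrite logn_gt0 mem_primes pp n0 pdiv_dvd.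
have m0 : (0 < m)%N by case: m nE {pm} => //; rewrite mul0n => nE; rewrite nE in n0.
rewrite m0 k0 -prime_coprime// mulnC -nE; split => //.
rewrite [ltnRHS]nE -[ltnLHS]muln1 ltn_pmul2l//.
by rewrite -(exp1n (logn (pdiv n) n)) ltn_exp2r ?prime_gt1.
Qed.

(** The coefficient at [n] of zeta(s) L(s, chi). *)
Definition chi_conv (n : nat) : int := \sum_(d <- divisors n) chi d.

(** By multiplicativity it suffices to look at prime powers, where the sum is
    1 + c + ... + c^k with c in {1, 0, -1}. *)
Lemma chi_conv_ge0 n : (0 < n)%N -> 0 <= chi_conv n.
Proof.
have [N] := ubnP n; elim: N n => // N IH n /ltnSE nN n0.
have [n1|n1] := leqP n 1.
  have -> : n = 1%N by case: n n0 n1 {nN} => [|[]].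
  by rewrite /chi_conv big_seq1.
have [p [k [m [pp /andP[m0 mn] pm _ nE]]]] := prime_power_split n1.
rewrite /chi_conv nE (perm_big _ (perm_divisorsM k pp m0 pm)) big_allpairs_dep.
under eq_bigr do under eq_bigr do rewrite chiM chiX.
under eq_bigr do rewrite -mulr_sumr.
rewrite -mulr_suml mulr_ge0//; last exact: (IH _ (leq_trans mn nN) m0).
rewrite -/(index_iota 0 k.+1).
have [->|->|->] := chi_cases p.
- by apply: sumr_ge0 => i _; rewrite expr1n.
- by apply: sumr_ge0 => i _; rewrite exprn_ge0.
- elim/ltn_ind: k {nE} => -[|[|k]] IHk; first by rewrite big_nat1.
    by rewrite !big_nat_recr// big_geq.
  by rewrite 2?big_nat_recr//= [(-1) ^+ k.+2]exprS mulN1r -addrA subrr addr0 IHk.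
Qed.

(** Products of primes that split in the field of discriminant -8. *)
Definition split_smooth (n : nat) := all (fun p => chi p == 1) (primes n).

Lemma split_smooth_dvd d n : (0 < n)%N -> (d %| n)%N ->
  split_smooth n -> split_smooth d.
Proof.
move=> n0 dn /allP sn; apply/allP => p; rewrite mem_primes => /and3P[pp d0 pd].
by apply: sn; rewrite mem_primes pp n0 (dvdn_trans pd).
Qed.

Lemma split_smoothM a b : (0 < a)%N -> (0 < b)%N ->
  split_smooth (a * b) = split_smooth a && split_smooth b.
Proof.
move=> a0 b0; apply/idP/andP => [s|[/allP sa /allP sb]].
  have ab : (0 < a * b)%N by rewrite muln_gt0 a0.
  by split; apply: (split_smooth_dvd ab _ s); [exact: dvdn_mulr|exact: dvdn_mull].
by apply/allP => p; rewrite primesM// => /orP[/sa|/sb].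
Qed.

Lemma chi_split_smooth n : (0 < n)%N -> split_smooth n -> chi n = 1.
Proof.
move=> n0 /allP sn; rewrite [in LHS](prod_prime_decomp n0) prime_decompE big_map.
rewrite (big_morph chi chiM (erefl _)) big_seq big1// => p /sn /eqP /= cp.
by rewrite chiX cp expr1n.
Qed.

Lemma chi_conv_split_smooth n : (0 < n)%N -> split_smooth n ->
  chi_conv n = (size (divisors n))%:R.
Proof.
move=> n0 sn; rewrite /chi_conv -sum1_size natr_sum big_seq [RHS]big_seq.
apply: eq_bigr => d; rewrite -dvdn_divisors// => dn.
by rewrite chi_split_smooth ?(dvdn_gt0 n0)//; apply: split_smooth_dvd sn.
Qed.

(** * The Chebyshev bound *)

Section VonMangoldt.
Variable R : realType.

Definition von_mangoldt (n : nat) : R :=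
  if primes n is [:: p] then ln p%:R else 0.

Lemma von_mangoldt_ge0 n : 0 <= von_mangoldt n.
Proof.
rewrite /von_mangoldt; case E : (primes n) => [|p [|? ?]]//.
have : p \in primes n by rewrite E inE.
by rewrite mem_primes => /andP[pp _]; rewrite ln_ge0// ler1n prime_gt0.
Qed.

(** Split off a full prime power, n = p^k m: among the divisors p^i d of n with i > 0
    and d | m, only those with d = 1 are prime powers; those with i = 0 give ln m. *)
Lemma sum_von_mangoldt n : (0 < n)%N ->
  \sum_(d <- divisors n) von_mangoldt d = ln n%:R.
Proof.
have [N] := ubnP n; elim: N n => // N IH n /ltnSE nN n0.
have [n1|n1] := leqP n 1.
  have -> : n = 1%N by case: n n0 n1 {nN} => [|[]].
  by rewrite big_seq1 ln1.
have [p [k [m [pp /andP[m0 mn] pm k0 nE]]]] := prime_power_split n1.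
rewrite nE (perm_big _ (perm_divisorsM k pp m0 pm)) big_allpairs_dep /= big_cons.
have -> : \sum_(d <- divisors m) von_mangoldt (p ^ 0 * d) = ln m%:R.
  rewrite -(IH m (leq_trans mn nN) m0).
  by apply: eq_bigr => d _; rewrite expn0 mul1n.
have p0 := prime_gt0 pp.
have -> : \sum_(i <- iota 1 k) \sum_(d <- divisors m) von_mangoldt (p ^ i * d)
          = \sum_(i <- iota 1 k) ln p%:R.
  rewrite big_seq [RHS]big_seq; apply: eq_bigr => i; rewrite mem_iota => /andP[i0 _].
  rewrite (bigD1_seq 1%N) ?divisors_uniq -?dvdn_divisors//= muln1.
  rewrite /von_mangoldt primesX// primes_prime// big_seq_cond big1 ?addr0// => d.
  rewrite -dvdn_divisors// => /andP[dm d1].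
  have d0 := dvdn_gt0 m0 dm.
  case E : (primes _) => [|q [|? ?]]//; exfalso.
  have : p \in primes (p ^ i * d).
    by rewrite mem_primes pp muln_gt0 expn_gt0 p0 d0 dvdn_mulr// dvdn_exp.
  have d1' : (1 < d)%N by case: d d0 d1 {dm E} => [|[]].
  have : pdiv d \in primes (p ^ i * d).
    by rewrite mem_primes pdiv_prime// muln_gt0 expn_gt0 p0 d0 dvdn_mull// pdiv_dvd.
  rewrite E !inE => /eqP <- /eqP pE; case/negP: pm; rewrite pE.
  exact: dvdn_trans (pdiv_dvd _) dm.
rewrite big_const_seq count_predT size_iota iter_addr_0 natrM natrX.
by rewrite lnM ?posrE ?exprn_gt0 ?ltr0n// lnXn ?ltr0n// addrC.
Qed.

Definition psi (n : nat) : R := \sum_(1 <= d < n.+1) von_mangoldt d.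

(** Legendre's formula, in the form of Chebyshev. *)
Lemma ln_fact n : ln (n`!%:R : R) = \sum_(1 <= d < n.+1) von_mangoldt d * (n %/ d)%:R.
Proof.
transitivity (\sum_(1 <= i < n.+1) ln (i%:R : R)).
  elim: n => [|n IH]; first by rewrite big_geq// ln1.
  rewrite big_nat_recr//= -IH factS natrM mulrC lnM ?posrE ?ltr0n ?fact_gt0//.
transitivity (\sum_(1 <= i < n.+1) \sum_(d <- divisors i) von_mangoldt d).
  rewrite [LHS]big_nat [RHS]big_nat.
  by apply: eq_bigr => i /andP[i0 _]; rewrite sum_von_mangoldt.
rewrite (hyperbola (fun d _ => von_mangoldt d)); apply: eq_bigr => d _.
by rewrite big_const_nat iter_addr_0 subn1 mulr_natr.
Qed.

(** floor(2n/d) - 2 floor(n/d) is nonnegative and equals 1 for n < d <= 2n, so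
    psi(2n) - psi(n) is at most the logarithm of the central binomial
    coefficient, which is at most 2n log 2. *)
Lemma psi_double n : psi (n + n) - psi n <= (n + n)%:R * ln 2.
Proof.
have cE : ln ('C(n + n, n)%:R : R) = ln (n + n)`!%:R - 2 * ln (n`!%:R).
  have := bin_fact (leq_addl n n); rewrite addnK => <-.
  rewrite !natrM !lnM ?posrE ?mulr_gt0 ?ltr0n ?fact_gt0 ?bin_gt0 ?leq_addl//.
  ring.
have : ln ('C(n + n, n)%:R : R) <= (n + n)%:R * ln 2.
  rewrite mulr_natl -lnXn// ler_ln ?posrE ?ltr0n ?bin_gt0 ?leq_addl ?exprn_gt0//.
  rewrite -natrX ler_nat (expnDn 1 1 (n + n)).
  have H : (n < (n + n).+1)%N by rewrite ltnS leq_addl.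
  rewrite (bigD1 (Ordinal H))//= !exp1n !muln1; exact: leq_addr.
apply: le_trans; rewrite cE !ln_fact.
have -> : \sum_(1 <= d < n.+1) von_mangoldt d * (n %/ d)%:R
        = \sum_(1 <= d < (n + n).+1) von_mangoldt d * (n %/ d)%:R.
  rewrite [RHS](big_cat_nat (n := n.+1))//=; last by rewrite ltnS leq_addl.
  rewrite [X in _ + X]big_nat [X in _ + X]big1 ?addr0// => d /andP[nd _].
  by rewrite divn_small// mulr0.
have psiE : psi n = \sum_(1 <= d < (n + n).+1) von_mangoldt d * (d <= n)%N%:R.
  rewrite [RHS](big_cat_nat (n := n.+1))//=; last by rewrite ltnS leq_addl.
  rewrite [X in _ + X]big_nat [X in _ + X]big1 ?addr0; last first.
    by move=> d /andP[nd _]; rewrite leqNgt nd mulr0.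
  rewrite /psi [LHS]big_nat [RHS]big_nat; apply: eq_bigr => d /andP[_].
  by rewrite ltnS => ->; rewrite mulr1.
rewrite psiE {1}/psi mulr_sumr -!sumrB !big_nat; apply: ler_sum => d /andP[d0 dn].
rewrite mulrCA -{1}[von_mangoldt d]mulr1 -!mulrBr ler_wpM2l ?von_mangoldt_ge0//.
rewrite lerBlDr.
suff : (1 + (n %/ d + n %/ d) <= (n + n) %/ d + (d <= n))%N.
  by rewrite -(ler_nat R) !natrD; lra.
case: (leqP d n) => nd; last by rewrite (divn_small nd) !addn0 divn_gt0//; lia.
by rewrite addn1 add1n ltnS leq_divRL//; have := leq_trunc_div n d; lia.
Qed.

(** Doubling from uphalf n costs a rounding; the constant 6 log 2 absorbs it for
    all n >= 2. *)
Lemma psi_le n : psi n <= 6 * ln 2 * n%:R.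
Proof.
have l2 : 0 <= ln (2 : R) by rewrite ln_ge0// ler1n.
elim/ltn_ind: n => -[|[|n]] IH; first by rewrite /psi big_geq// mulr0.
  by rewrite /psi big_nat1 /von_mangoldt/= mulr1 mulr_ge0.
set h := uphalf n.+2.
have hn : (h < n.+2)%N by rewrite /h /= uphalfE ltnS; lia.
have h2 : (n.+2 <= h + h)%N by rewrite addnn /h; lia.
have h3 : (h + h <= n.+3)%N by rewrite addnn /h; lia.
have psiM : psi n.+2 <= psi (h + h).
  rewrite /psi [leRHS](big_cat_nat (n := n.+3))//= lerDl.
  by apply: sumr_ge0 => d _; apply: von_mangoldt_ge0.
have := psi_double h; have := IH _ hn.
move: h3; rewrite -(ler_nat R) -[n.+3]addn3 -[in n.+2%:R]addn2 !natrD => h3.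
have : 0 <= n%:R :> R by [].
move: psiM l2 h3.
move: (psi _) (psi (h + h)) (psi h) (ln 2) (h%:R) (n%:R) => a b c l H x.
nra.
Qed.

End VonMangoldt.

(** * Integers of the form x^2 + 2 y^2 *)

(** The squares modulo 8 are 0, 1 and 4. *)
Lemma chi_quadratic_form u v : chi (u ^ 2 + 2 * v ^ 2) <> -1.
Proof.
rewrite -chi_mod -modnDm -modnMmr -(modnXm 2 8 u) -(modnXm 2 8 v).
apply/eqP.
have /allP/(_ (u %% 8)%N) : all (fun a => all (fun b =>
    chi ((a ^ 2 %% 8 + 2 * (b ^ 2 %% 8) %% 8) %% 8) != -1) (iota 0 8)) (iota 0 8).
  by vm_compute.
rewrite mem_iota ltn_pmod// => /(_ isT)/allP/(_ (v %% 8)%N).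
by rewrite mem_iota ltn_pmod//; apply.
Qed.

Lemma prime_sqN k : ~~ prime (k ^ 2).
Proof.
apply/negP => pk; have := logn_prime (k ^ 2) pk.
by rewrite eqxx lognX => /(congr1 odd); rewrite oddM.
Qed.

Lemma quadratic_form_transfer (F : comNzRingType) (u v x y : F) :
  u * y = - (v * x) -> x ^+ 2 + 2 * y ^+ 2 = 0 ->
  y ^+ 2 * (u ^+ 2 + 2 * v ^+ 2) = 0.
Proof.
move=> uv xy.
have -> : y ^+ 2 * (u ^+ 2 + 2 * v ^+ 2) = (u * y) ^+ 2 + 2 * v ^+ 2 * y ^+ 2.
  by ring.
rewrite uv; have -> : (- (v * x)) ^+ 2 + 2 * v ^+ 2 * y ^+ 2
                   = v ^+ 2 * (x ^+ 2 + 2 * y ^+ 2) by ring.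
by rewrite xy mulr0.
Qed.

(** Pigeonhole: there are more than p pairs (i, j) with 0 <= i, j <= sqrt p, so
    two of them give the same value of i y + j x modulo p; their difference
    (u, v) satisfies u y = -+ v x, and x^2 = -2 y^2 modulo p. *)
Lemma thue p x y : prime p -> ~~ (p %| y)%N -> (p %| x ^ 2 + 2 * y ^ 2)%N ->
  exists u v, [/\ (0 < u ^ 2 + 2 * v ^ 2)%N, (u ^ 2 < p)%N, (v ^ 2 < p)%N
                & (p %| u ^ 2 + 2 * v ^ 2)%N].
Proof.
move=> pp py pxy; have [K /andP[Kp pK]] := floor_sqrt p.
have natFp k : (k%:R == 0 :> 'F_p) = (p %| k)%N.
  by rewrite (dvdn_pcharf (pchar_Fp pp)).
pose f (w : 'I_K.+1 * 'I_K.+1) : 'F_p := (val w.1)%:R * y%:R + (val w.2)%:R * x%:R.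
have : ~~ injectiveb f.
  apply/negP => /injectiveP /leq_card.
  by rewrite card_prod !card_ord Fp_cast// mulnn leqNgt pK.
case/injectivePn => -[i j] [[i' j'] ne] fE.
pose u := ((val i - val i') + (val i' - val i))%N.
pose v := ((val j - val j') + (val j' - val j))%N.
have distE (a b : nat) : ((a - b + (b - a))%N%:R ^+ 2 = (a%:R - b%:R) ^+ 2 :> 'F_p).
  case: (leqP a b) => ab; rewrite natrD.
    by rewrite (eqP ab) add0r natrB// -sqrrN opprB.
  by rewrite (eqP (ltnW ab)) addr0 natrB// ltnW.
have sq (a b : 'I_K.+1) : (((val a - val b) + (val b - val a)) ^ 2 < p)%N.
  have le : (((val a - val b) + (val b - val a)) ^ 2 <= K ^ 2)%N.
    rewrite leq_sqr; case: a b => [a +] [b +] /=; rewrite !ltnS; clear; lia.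
  rewrite ltn_neqAle (leq_trans le Kp) andbT; apply: contraL pp => /eqP <-.
  exact: prime_sqN.
exists u, v; split; [| exact: sq | exact: sq | ].
  rewrite addn_gt0 muln_gt0 !expn_gt0 !orbF /= /u /v.
  apply: contraR ne; rewrite negb_or -!leqNgt xpair_eqE -!val_eqE /=.
  by clear; lia.
rewrite -natFp natrD natrM !natrX !distE.
have yN : y%:R != 0 :> 'F_p by rewrite natFp.
move: pxy; rewrite -natFp natrD natrM !natrX => /eqP xy0.
suff : y%:R ^+ 2 * (((val i)%:R - (val i')%:R) ^+ 2
    + 2 * ((val j)%:R - (val j')%:R) ^+ 2) = 0 :> 'F_p.
  by move=> /eqP; rewrite mulf_eq0 expf_eq0 (negbTE yN) andbF.
move: fE; rewrite /f /= => fE.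
have H : ((val i)%:R - (val i')%:R) * y%:R
    = - (((val j)%:R - (val j')%:R) * x%:R) :> 'F_p.
  apply/eqP; rewrite -subr_eq0 opprK; apply/eqP; move/eqP: fE.
  by rewrite -subr_eq0 => /eqP <-; rewrite /=; ring.
exact: quadratic_form_transfer H xy0.
Qed.

(** Otherwise Thue's lemma gives 0 < u^2 + 2 v^2 < 3p divisible by p, so that p or
    2p is of the form u^2 + 2 v^2; in the second case u is even and
    p = v^2 + 2 (u/2)^2.  Both contradict the residue of p modulo 8. *)
Lemma inert_dvd p x y : prime p -> chi p = -1 -> (p %| x ^ 2 + 2 * y ^ 2)%N ->
  (p %| x)%N /\ (p %| y)%N.
Proof.
move=> pp cp pxy; suff py : (p %| y)%N.
  move: pxy; rewrite dvdn_addl; last by rewrite dvdn_mull// dvdn_exp.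
  by rewrite Euclid_dvdX// => /andP[].
apply/negPn/negP => /(thue pp)/(_ pxy)[u [v [w0 up vp /dvdnP[t tE]]]].
have p0 := prime_gt0 pp.
have : (t * p < 3 * p)%N.
  by rewrite -tE; move: up vp; move: (u ^ 2)%N (v ^ 2)%N; clear; lia.
rewrite ltn_pmul2r//.
have quad a b : (a ^ 2 + 2 * b ^ 2)%N <> p.
  by move=> E; apply: (@chi_quadratic_form a b); rewrite E.
case: t tE => [|[|[|t]]]// tE _.
- by rewrite tE in w0.
- by apply: (quad u v); rewrite tE mul1n.
have : ~~ odd (u ^ 2 + 2 * v ^ 2) by rewrite tE oddM.
rewrite oddD oddM addbF oddX /= => uodd.
apply: (quad v u./2); have := odd_double_half u; rewrite (negbTE uodd) add0n => uE.
move: tE; rewrite -{1}uE -muln2; move: (u./2) => k.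
by rewrite expnMn; move: (v ^ 2)%N (k ^ 2)%N => V U; clear; lia.
Qed.

(** Inert primes occur to even powers and can be removed two at a time; the
    remaining prime factors are split, except for 2, whose exponent has either
    parity. *)
Lemma quadratic_form_split n x y : (0 < n)%N -> n = (x ^ 2 + 2 * y ^ 2)%N ->
  exists k m, [/\ (0 < k)%N, split_smooth m
                & n = (k ^ 2 * m)%N \/ n = (k ^ 2 * (2 * m))%N].
Proof.
elim/ltn_ind: n x y => n IH x y n0 nE.
have [/hasP[p]|] := boolP (has (fun p => chi p == -1) (primes n)).
  rewrite mem_primes n0 /= => /andP[pp pn] /eqP cp.
  have [/dvdnP[x' xE] /dvdnP[y' yE]] : (p %| x)%N /\ (p %| y)%N.
    by apply: inert_dvd => //; rewrite -nE.
  have p0 := prime_gt0 pp; have p1 := prime_gt1 pp.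
  have nE' : n = (p ^ 2 * (x' ^ 2 + 2 * y' ^ 2))%N.
    by rewrite nE xE yE !expnMn; ring.
  have n'0 : (0 < x' ^ 2 + 2 * y' ^ 2)%N.
    by move: n0; rewrite nE' muln_gt0 => /andP[].
  have n'n : (x' ^ 2 + 2 * y' ^ 2 < n)%N.
    by rewrite [ltnRHS]nE' -[ltnLHS]mul1n ltn_pmul2r// -(exp1n 2) ltn_sqr.
  have [k [m [k0 sm kE]]] := IH _ n'n x' y' n'0 erefl.
  exists (p * k)%N, m; split => //; first by rewrite muln_gt0 p0.
  by rewrite nE' (expnMn p k 2) -!(mulnA (p ^ 2)%N); case: kE => ->; [left|right].
rewrite -all_predC => /allP inert.
have [m m2 nE2] := pfactor_coprime (isT : prime 2) n0.
have m0 : (0 < m)%N by move: n0; rewrite nE2 muln_gt0 => /andP[].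
have sm : split_smooth m.
  apply/allP => p; rewrite mem_primes => /and3P[pp _ pm].
  have : p \in primes n by rewrite mem_primes pp n0 nE2 dvdn_mulr.
  move=> /inert /=; rewrite -chi_mod.
  have : odd p.
    have := pm; rewrite coprime2n in m2 => /dvdnP[t tE].
    by move: m2; rewrite tE oddM => /andP[].
  rewrite {1}(divn_eq p 8) oddD oddM andbF /=.
  have := ltn_pmod p (isT : 0 < 8)%N.
  by case: (p %% 8)%N => [|[|[|[|[|[|[|[|j]]]]]]]].
exists (2 ^ (logn 2 n)./2)%N, m; rewrite expn_gt0; split => //.
have := odd_double_half (logn 2 n); rewrite -expnM muln2.
case: (odd _); rewrite ?add0n ?add1n => E; [right|left].
  by rewrite mulnA -expnSr E mulnC.
by rewrite E mulnC.
Qed.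

(** * The Landau upper bound *)

Section Landau.
Variable R : realType.

Lemma harmonic_le_ln n : (0 < n)%N ->
  \sum_(1 <= e < n.+1) e%:R^-1 <= 1 + ln n%:R :> R.
Proof.
case: n => // n _; elim: n => [|n IH]; first by rewrite big_nat1 invr1 ln1 addr0.
rewrite big_nat_recr//=; apply: le_trans (lerD IH (lexx _)) _.
rewrite -addrA lerD2l.
have n1 : 0 < n.+1%:R :> R by rewrite ltr0n.
have n2 : 0 < n.+2%:R :> R by rewrite ltr0n.
have := @le_ln1Dx R (- (n.+2%:R)^-1).
have -> : 1 + - n.+2%:R^-1 = n.+1%:R / n.+2%:R :> R.
  rewrite -[X in X - _](divff (lt0r_neq0 n2)) -[X in _ - X]mul1r -mulrBl.
  by rewrite -natr1 addrK.
rewrite lnM ?posrE ?invr_gt0// lnV ?posrE// ltrN2 invf_lt1// ltr1n => /(_ isT).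
by move: (ln n.+1%:R) (ln n.+2%:R) (n.+2%:R^-1) => a b c; lra.
Qed.

Definition smooth_harmonic (x : nat) : R :=
  \sum_(1 <= m < x.+1) (split_smooth m)%:R / m%:R.

Lemma smooth_harmonic_ge0 x : 0 <= smooth_harmonic x.
Proof. by apply: sumr_ge0 => m _; rewrite divr_ge0. Qed.

(** The partial sums of chi lie between 0 and 2 and 1/d decreases. *)
Lemma sum_chi_div_le n : \sum_(1 <= d < n.+1) (chi d)%:~R / d%:R <= 2 :> R.
Proof.
(* [abel_bound] asks for a weight that decreases from index 0 on, whereas
   0%:R^-1 = 0 < 1%:R^-1. *)
rewrite big_nat.
under eq_bigr => d /andP[d0 _].
  have -> : d%:R^-1 = (maxn d 1)%:R^-1 :> R by rewrite (maxn_idPl d0).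
  over.
rewrite -big_nat.
have := @abel_bound R (fun d => (chi d)%:~R) (fun d => (maxn d 1)%:R^-1) 2 0 n.
rewrite mul0r addr0 invr1 mulr1; apply => //.
  move=> d; rewrite lef_pV2 ?posrE ?ltr0n ?leq_max ?orbT// ler_nat.
  by rewrite geq_max !leq_max leqnSn orbT.
move=> m; rewrite mul0r addr0 -rmorph_sum/= -[2]/(2%:~R) ler_int.
by have /andP[] := chi_sum m.
Qed.

(** The square is a sum of 1/(d e) over pairs with d e <= x^2 at most.  Grouping it
    by n = d e, each n contributes its number of divisors over n if it is
    smooth and nothing otherwise, hence at most [chi_conv n / n].  Summing
    chi(d)/(d e) over d first leaves a harmonic sum. *)
Lemma smooth_harmonic_sq x : (0 < x)%N ->
  smooth_harmonic x ^+ 2 <= 2 * (1 + 2 * ln x%:R).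
Proof.
move=> x0; set Y := (x * x)%N; have Y0 : (0 < Y)%N by rewrite muln_gt0 x0.
pose f (d e : nat) : R :=
  (split_smooth d)%:R / d%:R * ((split_smooth e)%:R / e%:R).
have f0 d e : 0 <= f d e by rewrite mulr_ge0 ?divr_ge0.
have -> : smooth_harmonic x ^+ 2 = \sum_(1 <= d < x.+1) \sum_(1 <= e < x.+1) f d e.
  rewrite expr2 {1}/smooth_harmonic mulr_suml; apply: eq_bigr => d _.
  by rewrite -mulr_sumr.
have widen (g : nat -> R) (a b : nat) : (a <= b)%N -> (forall i, 0 <= g i) ->
    \sum_(1 <= i < a.+1) g i <= \sum_(1 <= i < b.+1) g i.
  move=> ab g0; rewrite [leRHS](big_cat_nat (n := a.+1))//= lerDl.
  exact: sumr_ge0.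
have xY : (x <= Y)%N by rewrite leq_pmull.
apply: (@le_trans _ _ (\sum_(1 <= d < Y.+1) \sum_(1 <= e < (Y %/ d).+1) f d e)).
  apply: (@le_trans _ _ (\sum_(1 <= d < x.+1) \sum_(1 <= e < (Y %/ d).+1) f d e)).
    rewrite big_nat [leRHS]big_nat; apply: ler_sum => d /andP[d0 dx].
    apply: widen => //.
    by rewrite leq_divRL// leq_mul2l -ltnS dx orbT.
  by apply: widen => // d; apply: sumr_ge0.
rewrite -hyperbola.
apply: (@le_trans _ _ (\sum_(1 <= n < Y.+1) \sum_(d <- divisors n)
                         ((chi d)%:~R / d%:R * ((n %/ d)%N%:R)^-1))).
  rewrite big_nat [leRHS]big_nat; apply: ler_sum => n /andP[n0 _].
  have dE d : d \in divisors n -> f d (n %/ d)%N = (split_smooth n)%:R / n%:R.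
    rewrite -dvdn_divisors// => dn; have d0 := dvdn_gt0 n0 dn.
    have e0 : (0 < n %/ d)%N by rewrite divn_gt0// dvdn_leq.
    rewrite /f mulrACA -invfM -!natrM mulnb -split_smoothM//.
    by rewrite mulnC divnK// mulnC divnK.
  have cE d : d \in divisors n ->
      (chi d)%:~R / d%:R * ((n %/ d)%N%:R)^-1 = (chi d)%:~R / n%:R :> R.
    rewrite -dvdn_divisors// => dn.
    by rewrite -mulrA -invfM -natrM mulnC divnK.
  rewrite big_seq [leRHS]big_seq (eq_bigr _ dE) (eq_bigr _ cE) -!big_seq.
  have cc : \sum_(d <- divisors n) (chi d)%:~R = (chi_conv n)%:~R :> R.
    by rewrite /chi_conv rmorph_sum.
  rewrite -[leRHS]mulr_suml cc.
  rewrite big_const_seq count_predT iter_addr_0.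
  case sn : (split_smooth n).
    by rewrite chi_conv_split_smooth//= mul1r -[leLHS]mulr_natl rmorph_nat.
  by rewrite mul0r mul0rn divr_ge0// ler0z chi_conv_ge0.
rewrite (hyperbola (fun d e => (chi d)%:~R / d%:R * e%:R^-1)) hyperbola_swap.
apply: (@le_trans _ _ (\sum_(1 <= e < Y.+1) 2 * e%:R^-1)).
  apply: ler_sum => e _; rewrite -mulr_suml ler_wpM2r ?invr_ge0//.
  exact: sum_chi_div_le.
rewrite -mulr_sumr ler_wpM2l//; apply: le_trans (harmonic_le_ln Y0) _.
by rewrite natrM lnM ?posrE ?ltr0n//; lra.
Qed.

Definition smooth_count (x : nat) : R := \sum_(1 <= m < x.+1) (split_smooth m)%:R.

(** Write ln n as a sum of von_mangoldt d over d | n; the cofactor n/d is again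
    smooth, and for a fixed cofactor e the sum over d is at most psi(x/e). *)
Lemma sum_ln_smooth_le x :
  \sum_(1 <= n < x.+1) (split_smooth n)%:R * ln n%:R
    <= 6 * ln 2 * x%:R * smooth_harmonic x.
Proof.
apply: (@le_trans _ _ (\sum_(1 <= n < x.+1) \sum_(d <- divisors n)
   von_mangoldt R d * (split_smooth (n %/ d))%:R)).
  rewrite big_nat [leRHS]big_nat; apply: ler_sum => n /andP[n0 _].
  rewrite -sum_von_mangoldt// mulr_sumr big_seq [leRHS]big_seq.
  apply: ler_sum => d; rewrite -dvdn_divisors// => dn.
  rewrite mulrC ler_wpM2l ?von_mangoldt_ge0//.
  case sn : (split_smooth n) => //.
  by rewrite (split_smooth_dvd n0 (dvdn_div dn) sn).
rewrite (hyperbola (fun d e => von_mangoldt R d * (split_smooth e)%:R)) hyperbola_swap.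
rewrite mulr_sumr big_nat [leRHS]big_nat; apply: ler_sum => e /andP[e0 _].
rewrite -mulr_suml -/(psi R _) [leLHS]mulrC [leRHS]mulrCA ler_wpM2l//.
apply: le_trans (psi_le _ _) _; rewrite -[leRHS]mulrA ler_wpM2l//.
  by rewrite mulr_ge0// ln_ge0// ler1n.
by rewrite ler_pdivlMr ?ltr0n// -natrM ler_nat leq_trunc_div.
Qed.

(** This is n! >= (n/e)^n. *)
Lemma sum_ln_ratio_le x : (0 < x)%N ->
  x%:R * ln x%:R - \sum_(1 <= n < x.+1) ln n%:R <= x%:R :> R.
Proof.
case: x => // x _; elim: x => [|x IH]; first by rewrite big_nat1 ln1; lra.
rewrite big_nat_recr//=.
have x1 : 0 < x.+1%:R :> R by rewrite ltr0n.
have x2 : 0 < x.+2%:R :> R by rewrite ltr0n.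
have E : x.+2%:R = x.+1%:R + 1 :> R by rewrite -natr1.
have : ln x.+2%:R <= ln x.+1%:R + x.+1%:R^-1 :> R.
  have := @le_ln1Dx R (x.+1%:R^-1).
  have -> : 1 + x.+1%:R^-1 = x.+2%:R / x.+1%:R :> R.
    by rewrite E; field; rewrite lt0r_neq0.
  rewrite lnM ?posrE ?invr_gt0// lnV ?posrE//.
  have i0 : 0 < x.+1%:R^-1 :> R by rewrite invr_gt0.
  by move=> H; rewrite addrC -lerBlDr; apply: H; apply: lt_trans i0; lra.
move/(ler_wpM2l (ltW x1)); rewrite mulrDr divff ?lt0r_neq0//.
rewrite E mulrDl mul1r => H; lra.
Qed.

Lemma ln2_le1 : ln 2 <= 1 :> R.
Proof. by have := @le_ln1Dx R 1; apply; lra. Qed.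

(** For y > L the count is O(y / sqrt(ln y)); the cutoff L makes the bound linear
    in y, the form required by [abel_bound]. *)
Lemma smooth_count_le (L y : nat) : 1 <= ln L%:R :> R ->
  smooth_count y <= L%:R + 19 / Num.sqrt (ln L%:R) * y%:R.
Proof.
move=> L1.
have cnt_le x : smooth_count x <= x%:R.
  have : smooth_count x <= \sum_(1 <= m < x.+1) 1.
    by apply: ler_sum => m _; case: split_smooth.
  by rewrite big_const_nat iter_addr_0 subn1.
have [yL|Ly] := leqP y L.
  by apply: le_trans (cnt_le y) _; rewrite -[leLHS]addr0 lerD// ?ler_nat//.
have L0 : (0 < L)%N by case: L L1 {Ly} => //; rewrite ln0// ler10.
have y0 := ltn_trans L0 Ly.
have Lly : ln L%:R <= ln y%:R :> R by rewrite ler_ln ?posrE ?ltr0n// ler_nat ltnW.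
set t := Num.sqrt (ln y%:R : R).
have t2 : t ^+ 2 = ln y%:R by rewrite sqr_sqrtr//; lra.
have t1 : 1 <= t by rewrite -sqrtr1 ler_sqrt//; lra.
have Bt : smooth_harmonic y <= 3 * t.
  rewrite -ler_sqr ?nnegrE ?smooth_harmonic_ge0//; last by lra.
  by apply: le_trans (smooth_harmonic_sq y0) _; rewrite -t2; nra.
(* 19 = 6 * 3 + 1: the sum of ln n over smooth n gives 6 (ln 2) (3 t) y, and that
   of ln (y / n) at most y <= t y. *)
have main : smooth_count y * t ^+ 2 <= 19 * y%:R * t.
  have := sum_ln_ratio_le y0.
  have -> : y%:R * ln y%:R - \sum_(1 <= n < y.+1) ln n%:R
          = \sum_(1 <= n < y.+1) (ln y%:R - ln n%:R) :> R.
    by rewrite sumrB big_const_nat iter_addr_0 subn1 mulr_natl.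
  move=> A.
  have : \sum_(1 <= n < y.+1) (split_smooth n)%:R * (ln y%:R - ln n%:R)
         <= y%:R :> R.
    apply: le_trans A; rewrite big_nat [leRHS]big_nat; apply: ler_sum => n /andP[n0 ny].
    rewrite ler_piMl//; last by case: split_smooth.
    by rewrite subr_ge0 ler_ln ?posrE ?ltr0n// ler_nat.
  under eq_bigr do rewrite mulrBr.
  rewrite sumrB -mulr_suml -/(smooth_count y) -t2 => C.
  have D := sum_ln_smooth_le y.
  have E : 6 * ln 2 * y%:R * smooth_harmonic y <= 6 * y%:R * (3 * t).
    apply: ler_pM => //; last by apply: ler_wpM2r => //; have := ln2_le1; lra.
      by rewrite !mulr_ge0// ln_ge0// ler1n.
    exact: smooth_harmonic_ge0.
  have : 0 <= y%:R :> R by [].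
  nra.
have t0 : 0 < t by lra.
have cy : smooth_count y <= 19 * y%:R / t.
  rewrite ler_pdivlMr//; rewrite -(ler_pM2r t0) -mulrA -expr2 mulrAC; lra.
apply: le_trans cy _; rewrite -[leLHS]add0r lerD// mulrAC.
rewrite ler_wpM2r// ler_wpM2l// lef_pV2 ?posrE//; last by rewrite sqrtr_gt0; lra.
by rewrite ler_sqrt//; lra.
Qed.

Lemma sum_inv_sq K : \sum_(1 <= k < K.+1) (k%:R ^+ 2)^-1 <= 2 :> R.
Proof.
case: K => [|K]; first by rewrite big_geq.
suff : \sum_(1 <= k < K.+2) (k%:R ^+ 2)^-1 <= 2 - K.+1%:R^-1 :> R.
  by move=> H; apply: le_trans H _; rewrite gerBl invr_ge0.
elim: K => [|K IH]; first by rewrite big_nat1 expr1n invr1; lra.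
rewrite big_nat_recr//=; apply: le_trans (lerD IH (lexx _)) _.
have : 0 < K.+1%:R :> R by rewrite ltr0n.
rewrite -[K.+2%:R]natr1; move: (K.+1%:R) => x x0.
have x1 : 0 < x + 1 by lra.
rewrite -addrA lerD2l lerNr opprD opprK -subr_ge0.
have -> : x^-1 - (x + 1) ^- 2 - (x + 1)^-1 = x^-1 * (x + 1) ^- 2.
  by field; rewrite !lt0r_neq0.
by rewrite mulr_ge0 ?invr_ge0 ?exprn_ge0 ?ltW.
Qed.

(** Group the integers counted by the square k^2 of [quadratic_form_split].  The
    cutoffs contribute 2 L sqrt n, which the inequality of arithmetic and
    geometric means splits into L^3 + n / L. *)
Lemma quadratic_form_count (s : pred nat) (L n : nat) :
    (forall i, s i -> exists x y, i = (x ^ 2 + 2 * y ^ 2)%N) ->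
    1 <= ln L%:R :> R ->
  \sum_(1 <= i < n.+1) (s i)%:R <= L%:R ^+ 3 + 77 / Num.sqrt (ln L%:R) * n%:R :> R.
Proof.
move=> sP L1; have [K /andP[Kn nK]] := floor_sqrt n.
pose h e := ((2 %| e)%N && split_smooth (e %/ 2))%:R : R.
pose g e := (split_smooth e)%:R + h e.
have g0 e : 0 <= g e by rewrite addr_ge0.
have ptw i : (1 <= i < n.+1)%N ->
    (s i)%:R <= \sum_(1 <= k < K.+1 | (k ^ 2 %| i)%N) g (i %/ k ^ 2)%N.
  move=> /andP[i0]; rewrite ltnS => iltn; case si : (s i); last by apply: sumr_ge0.
  have [x [y iE]] := sP _ si.
  have [k [m [k0 sm kE]]] := quadratic_form_split i0 iE.
  have k20 : (0 < k ^ 2)%N by rewrite expn_gt0 k0.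
  have ki : (k ^ 2 %| i)%N by case: kE => ->; apply: dvdn_mulr.
  have kK : (k < K.+1)%N.
    rewrite -ltn_sqr; apply: leq_ltn_trans nK.
    by apply: leq_trans iltn; apply: dvdn_leq.
  rewrite -big_filter (bigD1_seq k)/=; last 2 first.
  - by rewrite mem_filter ki mem_index_iota k0.
  - exact/filter_uniq/iota_uniq.
  rewrite -[leLHS]addr0 lerD// ?sumr_ge0//.
  rewrite /g /h; case: kE => ->; rewrite mulKn// ?sm ?lerDl//.
  by rewrite dvdn_mulr// mulKn// sm lerDr.
apply: (@le_trans _ _ (\sum_(1 <= i < n.+1)
    \sum_(1 <= k < K.+1 | (k ^ 2 %| i)%N) g (i %/ k ^ 2)%N)).
  by rewrite big_nat [leRHS]big_nat; apply: ler_sum.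
rewrite (exchange_big_dep xpredT)//=.
have gsum Y : \sum_(1 <= e < Y.+1) g e <= 2 * smooth_count Y.
  rewrite big_split/= mulrDl mul1r lerD2l.
  have -> : \sum_(1 <= e < Y.+1) h e
          = \sum_(1 <= e < Y.+1 | (2 %| e)%N) (split_smooth (e %/ 2))%:R.
    by rewrite [RHS]big_mkcond; apply: eq_bigr => e _; rewrite /h; case: (2 %| e)%N.
  rewrite (sum_multiples (fun e => (split_smooth e)%:R))// /smooth_count.
  rewrite [leRHS](big_cat_nat (n := (Y %/ 2).+1))//= ?lerDl ?sumr_ge0//.
  by rewrite ltnS leq_div.
set v := Num.sqrt (ln L%:R).
have v1 : 1 <= v by rewrite -sqrtr1 ler_sqrt//; lra.
have L0 : (0 < L)%N by case: L L1 {v v1} => //; rewrite ln0// ler10.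
apply: (@le_trans _ _
    (\sum_(1 <= k < K.+1) (2 * L%:R + 38 / v * n%:R * (k%:R ^+ 2)^-1))).
  rewrite big_nat [leRHS]big_nat; apply: ler_sum => k /andP[k0 _].
  rewrite sum_multiples ?expn_gt0 ?k0//; apply: le_trans (gsum _) _.
  have : smooth_count (n %/ k ^ 2) <= L%:R + 19 / v * (n%:R * (k%:R ^+ 2)^-1).
    apply: le_trans (smooth_count_le _ L1) _; rewrite -/v lerD2l ler_wpM2l//.
      by rewrite divr_ge0//; lra.
    by rewrite ler_pdivlMr ?exprn_gt0 ?ltr0n// -natrX -natrM ler_nat leq_trunc_div.
  lra.
rewrite big_split/= big_const_nat iter_addr_0 subn1 -mulr_natr -mulr_sumr.
have A : 38 / v * n%:R * \sum_(1 <= k < K.+1) (k%:R ^+ 2)^-1 <= 38 / v * n%:R * 2.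
  by rewrite ler_wpM2l ?sum_inv_sq// mulr_ge0// divr_ge0//; lra.
have L1' : 1 <= L%:R :> R by rewrite ler1n.
have vL : v <= L%:R.
  rewrite -ler_sqr ?nnegrE//; last by lra.
  rewrite sqr_sqrtr; last by lra.
  have : ln L%:R <= L%:R - 1 :> R.
    by have := @le_ln1Dx R (L%:R - 1); rewrite addrCA subrr addr0; apply; lra.
  nra.
have B : 2 * L%:R * K%:R <= L%:R ^+ 3 + v^-1 * n%:R.
  have K2 : K%:R ^+ 2 <= n%:R :> R by rewrite -natrX ler_nat.
  apply: (@le_trans _ _ (L%:R ^+ 3 + L%:R^-1 * K%:R ^+ 2)).
    have LL : L%:R * L%:R^-1 = 1 :> R by rewrite divff// lt0r_neq0//; lra.
    have : 0 <= L%:R * (L%:R - L%:R^-1 * K%:R) ^+ 2 :> R.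
      by rewrite mulr_ge0// sqr_ge0.
    have -> : L%:R * (L%:R - L%:R^-1 * K%:R) ^+ 2 =
       L%:R ^+ 3 + (L%:R * L%:R^-1) * L%:R^-1 * K%:R ^+ 2
       - 2 * L%:R * (L%:R * L%:R^-1) * K%:R :> R by ring.
    rewrite LL; lra.
  rewrite lerD2l ler_pM ?invr_ge0 ?exprn_ge0// lef_pV2 ?posrE//; lra.
lra.
Qed.

Lemma sum_geometric_le (z : R) M : 0 < z < 1 ->
  \sum_(1 <= i < M.+1) z ^+ i <= 1 / (1 - z).
Proof.
move=> /andP[z0 z1]; rewrite ler_pdivlMr ?subr_gt0//.
have -> : (\sum_(1 <= i < M.+1) z ^+ i) * (1 - z) = z - z ^+ M.+1.
  elim: M => [|M IH]; first by rewrite big_geq// mul0r expr1 subrr.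
  by rewrite big_nat_recr//= mulrDl IH [in RHS]exprS; ring.
by have := exprn_gt0 M.+1 z0; lra.
Qed.

(** With X = 1/(1-z), the choice L = floor(X^(1/4)) makes L^3 negligible against
    X / sqrt(ln X) while ln L is still a constant multiple of ln X. *)
Lemma quadratic_form_series_le (s : pred nat) (z : R) (M : nat) :
    (forall i, s i -> exists x y, i = (x ^ 2 + 2 * y ^ 2)%N) ->
    0 < z < 1 -> 8 <= ln (1 / (1 - z)) ->
  \sum_(1 <= i < M.+1) (s i)%:R * z ^+ i
    <= 233 * (1 / ((1 - z) * Num.sqrt (ln (1 / (1 - z))))).
Proof.
move=> sP z01 lnX8; have /andP[z0 z1] := z01.
set X := 1 / (1 - z) in lnX8 *; have X0 : 0 < X by rewrite divr_gt0// subr_gt0.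
set u := Num.sqrt (ln X).
have -> : 1 / ((1 - z) * u) = X / u by rewrite invfM mulrA.
pose Y := Num.sqrt (Num.sqrt X).
have Y0 : 0 < Y by rewrite !sqrtr_gt0.
have YX : Y ^+ 4 = X by rewrite (exprM _ 2 2) !sqr_sqrtr// ?sqrtr_ge0 ltW.
have lnYX : ln X = 4 * ln Y by rewrite -YX lnXn// mulr_natl.
have lnYle : ln Y <= Y - 1.
  by have := @le_ln1Dx R (Y - 1); rewrite addrCA subrr addr0; apply; lra.
pose L := Num.truncn Y.
have /andP[LY YL] : L%:R <= Y < L.+1%:R by apply: truncn_itv; exact: ltW.
have {}YL : Y - 1 <= L%:R by rewrite lerBlDr natr1 ltW.
have L0 : 0 < L%:R :> R by lra.
have lnL : ln X <= 8 * ln L%:R.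
  have : ln Y <= ln (L%:R ^+ 2 : R).
    by rewrite ler_ln ?posrE ?exprn_gt0//; nra.
  by rewrite lnXn// -mulr_natl; lra.
have L1 : 1 <= ln L%:R :> R by lra.
have u2 : u ^+ 2 = ln X by rewrite sqr_sqrtr//; lra.
have u0 : 0 < u by rewrite sqrtr_gt0; lra.
set v := Num.sqrt (ln L%:R : R).
have v2 : v ^+ 2 = ln L%:R by rewrite sqr_sqrtr//; lra.
have v0 : 0 < v by rewrite sqrtr_gt0; lra.
have uv : u <= 3 * v by rewrite -ler_sqr ?nnegrE; nra.
have uY : u <= 2 * Y by rewrite -ler_sqr ?nnegrE; nra.
have L3 : L%:R ^+ 3 <= 2 * (X / u).
  apply: (@le_trans _ _ (Y ^+ 3)); first by apply: lerXn2r => //; rewrite nnegrE ltW.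
  rewrite mulrA ler_pdivlMr// -YX.
  have : 0 < Y ^+ 3 by rewrite exprn_gt0.
  rewrite [Y ^+ 4]exprSr; nra.
have vX : 77 / v * X <= 231 * (X / u).
  rewrite [leRHS]mulrA ler_pdivlMr// mulrAC -[leLHS]mulrA mulrAC ler_pdivrMr//.
  by nra.
have := @abel_bound R (fun i => (s i)%:R) (fun i => z ^+ i) (L%:R ^+ 3) (77 / v) M.
move=> /(_ (exprn_ge0 _ (ltW L0)) (fun n => exprn_ge0 n (ltW z0))) H.
apply: le_trans (H _ _) _.
- by move=> n; rewrite exprS ler_piMl ?exprn_ge0// ltW.
- by move=> n; apply: quadratic_form_count.
apply: (@le_trans _ _ (L%:R ^+ 3 + 77 / v * X)).
  apply: lerD; first by rewrite expr1 ler_piMr ?exprn_ge0// ltW.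
  by rewrite ler_wpM2l ?sum_geometric_le// divr_ge0// ltW.
lra.
Qed.

End Landau.

(** * Limits of the two series *)

Lemma p2_series_bound (R : realType) (z : R) M : 0 < z < 1 ->
  \sum_(1 <= n < M.+1) `|(p2 n)%:~R * z ^+ n| <= 1 / (1 - z).
Proof.
move=> z01; have /andP[z0 z1] := z01.
have := @abel_bound R (fun n => `|(p2 n)%:~R|) (fun n => z ^+ n) 0 1 M (lexx 0).
rewrite mul0r add0r mul1r => H; apply: le_trans (sum_geometric_le M z01).
under eq_bigr do rewrite normrM (ger0_norm (exprn_ge0 _ (ltW z0))).
apply: H.
- by move=> n; rewrite exprn_ge0// ltW.
- by move=> n; rewrite exprS ler_piMl ?exprn_ge0// ltW.
- move=> n; rewrite add0r mul1r.
  have := sum_abs_p2_le n; rewrite -(ler_int R) rmorph_sum /= natz.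
  by under eq_bigr do rewrite intr_norm.
Qed.

Lemma limn_le_bound (R : realType) (u : R^nat) (B : R) : cvgn u ->
  (forall n, `|u n| <= B) -> `|limn u| <= B.
Proof.
move=> cu uB; rewrite ler_norml; apply/andP.
by split; [apply: limr_ge|apply: limr_le] => //; apply: nearW => n;
  have := uB n; rewrite ler_norml => /andP[].
Qed.

(** Absolute convergence, with the bound carried over to the limit. *)
Lemma abs_bounded_series (R : realType) (u : R^nat) (B : R) :
    (forall M, \sum_(1 <= n < M.+1) `|u n| <= B) ->
  cvgn [sequence \sum_(1 <= n < N) u n]_N /\
  `|limn [sequence \sum_(1 <= n < N) u n]_N| <= B.
Proof.
move=> uB; pose v n := if n is 0%N then 0 else u n.
have vE (h : R -> R) N : h 0 = 0 ->
    \sum_(0 <= n < N) h (v n) = \sum_(1 <= n < N) h (u n).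
  move=> h0; case: N => [|N]; first by rewrite !big_geq.
  rewrite big_ltn//= h0 add0r [LHS]big_nat [RHS]big_nat.
  by apply: eq_bigr => -[].
have absB N : \sum_(1 <= n < N) `|u n| <= B.
  by case: N => [|N]; [have := uB 0%N; rewrite !big_geq|].
have -> : [sequence \sum_(1 <= n < N) u n]_N = series v.
  by apply/funext => N; rewrite /= -(vE id).
have cv : cvgn (series v).
  apply: normed_cvg; apply: nondecreasing_is_cvgn.
    by apply: nondecreasing_series => n _ _ /=.
  by exists B => _ [N _ <-]; have := absB N; rewrite -(vE (fun x => `|x|)) ?normr0.
split=> //; apply: limn_le_bound => // N; rewrite /series /= (vE id)//.
exact: le_trans (ler_norm_sum _ _ _) (absB N).
Qed.

Unset Implicit Arguments.

Theorem theorem1p3 (R : realType) :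
  [/\ (forall z : R, 0 < z < 1 ->
         cvgn (p2_series z) /\ cvgn (p2_pos_series z)),
      bigO_left1 (fun z : R => limn (p2_series z))
                 (fun z : R => 1 / (1 - z)) &
      bigO_left1 (fun z : R => limn (p2_pos_series z))
                 (fun z : R => 1 / ((1 - z) * Num.sqrt (ln (1 / (1 - z)))))].
Proof.
have posE (z : R) : p2_pos_series z =
    [sequence \sum_(1 <= n < N) (0 < p2 n)%R%:R * z ^+ n]_N.
  apply/funext => N; rewrite /p2_pos_series /= big_mkcond; apply: eq_bigr => n _.
  by case: ifP; rewrite ?mul1r ?mul0r.
have posn (z : R) n : 0 < z -> `|(0 < p2 n)%R%:R * z ^+ n| = (0 < p2 n)%R%:R * z ^+ n.
  by move=> z0; rewrite ger0_norm// mulr_ge0// exprn_ge0// ltW.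
split.
- move=> z z01; have /andP[z0 _] := z01; split.
    by have [] := abs_bounded_series (fun M => p2_series_bound M z01).
  rewrite posE; apply: (proj1 (abs_bounded_series (B := 1 / (1 - z)) _)) => M.
  apply: le_trans (sum_geometric_le M z01); apply: ler_sum => n _.
  by rewrite posn//; case: (0 < p2 n); rewrite ?mul1r// mul0r exprn_ge0// ltW.
- exists 1 => //; near=> z; have z01 : 0 < z < 1.
    by apply/andP; split; near: z; [exact: nbhs_left_gt|exact: nbhs_left_lt].
  by rewrite mul1r; have [] := abs_bounded_series (fun M => p2_series_bound M z01).
- exists 233 => //; near=> z.
  have z1 : z < 1 by near: z; exact: nbhs_left_lt.
  (* This forces ln (1 / (1 - z)) >= 8, the range of [quadratic_form_series_le]. *)
  have zl : 1 - expR (- 8) < z by near: z; apply: nbhs_left_gt; rewrite gtrBl expR_gt0.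
  have e1 : expR (- 8) <= 1 :> R by rewrite -expR0 ler_expR oppr_le0.
  have z0 : 0 < z by apply: le_lt_trans zl; rewrite subr_ge0.
  have z01 : 0 < z < 1 by rewrite z0.
  have X8 : 8 <= ln (1 / (1 - z)).
    rewrite div1r lnV ?posrE ?subr_gt0// lerNr -[leRHS]expRK.
    by rewrite ler_ln ?posrE ?subr_gt0 ?expR_gt0// lerBlDr -lerBlDl ltW.
  rewrite posE; apply: (proj2 (abs_bounded_series _)) => M.
  under eq_bigr do rewrite posn//.
  apply: (quadratic_form_series_le (s := fun n => (0 < p2 n)%R)) => // n.
  exact: p2_gt0_quadratic_form.
Unshelve. all: by end_near. Qed.
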